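(* Let $X$, $Y$ be Polish spaces and $A$ a Borel subset of $X\times Y$. Then exactly one of the following holds: (a) $A$ is potentially ${\bf\Pi}^0_1$. (b) There are continuous maps $u:2^{\mathbb{N}}\to X$ and $v:2^{\mathbb{N}}\to Y$ with $A_0=(u\times v)^{-1}(A)\cap\overline{A_0}$. Moreover, neither of the following strengthenings of this statement is true: (i) the version in which $u$ and $v$ in (b) are additionally required to be one-to-one; (ii) the version in which (b) is replaced by ''there are continuous $u:2^{\mathbb{N}}\to X$, $v:2^{\mathbb{N}}\to Y$ with $A_0=(u\times v)^{-1}(A)$''. That is, for each of (i), (ii) there are Polish spaces $X,Y$ and a Borel set $A\subseteq X\times Y$ which is not potentially ${\bf\Pi}^0_1$ and for which no maps $u,v$ as required exist.
   Context: A Borel set $A\subseteq X\times Y$ ($X,Y$ Polish) is potentially in a class $\Gamma$ (here $\Gamma={\bf\Pi}^0_1$, closed sets) if there are finer Polish topologies $\sigma$ on $X$ and $\tau$ on $Y$ such that $A\in\Gamma([X,\sigma]\times[Y,\tau])$. Let $\psi:\mathbb{N}\to 2^{<\mathbb{N}}$ be the natural bijection enumerating finite binary sequences by length and then lexicographically ($\psi(0)=\emptyset,\psi(1)=0,\psi(2)=1,\psi(3)=00,\psi(4)=01,\psi(5)=10,\psi(6)=11,\ldots$); then $|\psi(n)|\le n$ and we set $s_n:=\psi(n)0^{n-|\psi(n)|}$ (so $|s_n|=n$). Define $A_0:=\{(s_n0\gamma,s_n1\gamma): n\in\mathbb{N},\gamma\in 2^{\mathbb{N}}\}\subseteq 2^{\mathbb{N}}\times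 2^{\mathbb{N}}$, and $\overline{A_0}$ is its closure in $2^{\mathbb{N}}\times 2^{\mathbb{N}}$. *)

(* Defs.v *)
From HB Require Import structures.
From mathcomp Require Import all_boot all_order all_algebra.
From mathcomp Require Import all_classical all_reals all_analysis.

Set Implicit Arguments.
Unset Strict Implicit.
Unset Printing Implicit Defensive.

Local Open Scope classical_set_scope.

Definition separable (T : topologicalType) : Prop :=
  exists2 D : set T, countable D & dense D.

(* [m] ranges over the metric structures on the carrier of [T]; completeness is
   the library's filter form, without the nonemptiness that its class
   [Complete] imposes. *)
Definition completely_metrizable (R : realType) (T : topologicalType) : Prop :=
  exists m : Metric R T,
    let M : metricType R := Metric.Pack m in
    (forall U : set T, @open M U <-> @open T U) /\
    (forall F : set_system M, ProperFilter F -> cauchy F ->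
       exists x : M, F --> x).

Definition polish (R : realType) (T : topologicalType) : Prop :=
  separable T /\ completely_metrizable R T.

Definition borel (T : topologicalType) : set (set T) := <<s @open T >>.

(* [s] and [t] range over the topologies on the carriers of [X] and [Y]. *)
Definition potentially_closed (R : realType) (X Y : topologicalType)
    (A : set (X * Y)) : Prop :=
  exists (s : Topological X) (t : Topological Y),
    let X' : topologicalType := Topological.Pack s in
    let Y' : topologicalType := Topological.Pack t in
    [/\ @open X `<=` @open X', @open Y `<=` @open Y',
        polish R X', polish R Y' & @closed (X' * Y')%type A].

(* The binary sequences of length l are numbered 2^l - 1, ..., 2^(l+1) - 2 in
   lexicographic order, so the n-th sequence consists of the binary digits of
   n + 1, most significant first, without the leading 1. *)
Definition psi (n : nat) : seq bool :=
  let l := trunc_log 2 n.+1 in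
  mkseq (fun i => odd (n.+1 %/ 2 ^ (l - i.+1))) l.

Lemma psi_values :
  map psi (iota 0 7) =
  [:: [::]; [:: false]; [:: true]; [:: false; false]; [:: false; true];
      [:: true; false]; [:: true; true]].
Proof. by []. Qed.

Lemma size_psi (n : nat) : size (psi n) = trunc_log 2 n.+1.
Proof. exact: size_mkseq. Qed.

Lemma size_psi_le (n : nat) : size (psi n) <= n.
Proof.
rewrite size_psi -ltnS; have := trunc_logP (isT : 1 < 2) (ltn0Sn n).
by apply: leq_trans; exact: ltn_expl.
Qed.

Definition sseq (n : nat) : seq bool := psi n ++ nseq (n - size (psi n)) false.

Lemma size_sseq (n : nat) : size (sseq n) = n.
Proof. by rewrite size_cat size_nseq subnKC// size_psi_le. Qed.

(* The default value of [nth] is returned exactly at positions past [s]. *)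
Definition prepend (s : seq bool) (g : cantor_space) : cantor_space :=
  fun i => nth (g (i - size s)) s i.

Definition A0 : set (cantor_space * cantor_space) :=
  [set p | exists (n : nat) (g : cantor_space),
     p = (prepend (rcons (sseq n) false) g, prepend (rcons (sseq n) true) g)].

(* Main.v *)
Require Import Defs.
From HB Require Import structures.
From mathcomp Require Import all_boot all_order all_algebra.
From mathcomp Require Import all_classical all_reals all_analysis.
From mathcomp Require Import lra.

(**
By [closure A0 = A0 U diagonal], alternative (b) asks for continuous [u], [v]
with [(u al, v al)] outside [A] for all [al] and [(u a, v b)] in [A] for all
[(a, b)] in [A0].

If [A] is not potentially closed then its complement is not a countable union
of Borel rectangles, since countably many Borel sets can be made clopen in a
finer Polish topology.  Let [chi] and [phi] be continuous surjections from
closed subsets of the Baire space onto the complement of [A] and onto [A].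
Finite configurations approximating [u], [v] and the witnesses for [A] are
built in the style of B. Miller's proof of the G_0 dichotomy: an approximation
is bad if it has no one-step extension once some countable union of Borel
rectangles disjoint from [A] is discarded; Lusin separation encloses the points
produced by a bad approximation in one more such rectangle, and there are only
countably many approximations, so one union of rectangles serves for all of
them.  Either the empty approximation is bad, and the complement of [A] is a
countable union of rectangles, or good approximations extend forever and
converge to [u] and [v].

Both alternatives cannot hold: the open sets of a finer Polish topology are
Borel, so a covering of the diagonal by countably many rectangles has, by Baire
category, a rectangle which contains a pair of [A0].

For the two examples, the complement of the diagonal has no reduction on the
whole plane.  For injectivity, [mask] erases from a sequence, whenever a 1
occurs at the node [s_n], the coordinates attached to nodes above [s_n 0]; the
edges [(x, mask (flip n x))] then force [v] to identify two points.
*)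

Set Implicit Arguments.
Unset Strict Implicit.
Unset Printing Implicit Defensive.

Import Order.TTheory GRing.Theory Num.Theory.

Local Open Scope classical_set_scope.

(** * Metrics and Polish spaces *)

Section Distance.
Variable R : realType.
Local Open Scope ring_scope.

(** Distances are bare functions, so that a second distance inducing a finer topology can be put on
    the same carrier. *)
Definition is_dist (T : Type) (d : T -> T -> R) : Prop :=
  [/\ forall x, d x x = 0, forall x y, d x y = 0 -> x = y,
      forall x y, d x y = d y x & forall y x z, d x z <= d x y + d y z].

Definition dist_open (T : Type) (d : T -> T -> R) (U : set T) : Prop :=
  forall x, U x -> exists2 e : R, 0 < e & forall y, d x y < e -> U y.

Definition dist_complete (T : Type) (d : T -> T -> R) : Prop :=
  forall u : nat -> T,
    (forall e : R, 0 < e -> exists N, forall m n, (N <= m)%N -> (N <= n)%N ->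
       d (u m) (u n) < e) ->
    exists l, forall e : R, 0 < e -> exists N, forall n,
      (N <= n)%N -> d (u n) l < e.

Definition polish_dist (T : topologicalType) (d : T -> T -> R) : Prop :=
  [/\ is_dist d, forall U : set T, open U <-> dist_open d U & dist_complete d].

Lemma invS_lt (e : R) : 0 < e -> exists n : nat, n.+1%:R^-1 < e.
Proof.
move=> e0; have [n /=] := near_infty_natSinv_lt (PosNum e0).
by move=> _ /(_ n (leqnn n)); exists n.
Qed.

Lemma invS_gt0 (n : nat) : 0 < n.+1%:R^-1 :> R.
Proof. by rewrite invr_gt0 ltr0n. Qed.

Lemma invS_le (m n : nat) : (m <= n)%N -> n.+1%:R^-1 <= m.+1%:R^-1 :> R.
Proof. by move=> mn; rewrite lef_pV2 ?posrE ?ltr0n// ler_nat ltnS. Qed.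

Lemma lt_halves (a b c e : R) :
  a < e / 2 -> b < e / 2 -> c <= a + b -> c < e.
Proof. by lra. Qed.

Lemma is_dist_ge0 (T : Type) (d : T -> T -> R) : is_dist d ->
  forall x y, 0 <= d x y.
Proof.
move=> [d0 _ ds dt] x y; have := dt y x x.
by rewrite d0 (ds y x); lra.
Qed.

Lemma metric_openE (M : metricType R) (U : set M) :
  open U <-> dist_open (@mdist R M) U.
Proof.
rewrite openE; split.
- move=> oU x /oU; rewrite /interior -nbhs_ballE => -[e /= e0 eU].
  by exists e => // y xy; apply: eU; rewrite ballEmdist.
- move=> dU x /dU[e e0 eU]; rewrite /interior -nbhs_ballE; exists e => //= y.
  by rewrite ballEmdist => /eU.
Qed.

Lemma metric_polish_dist (T : topologicalType) : completely_metrizable R T ->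
  exists d : T -> T -> R, polish_dist d.
Proof.
move=> [m [/= mo mc]]; set M : metricType R := Metric.Pack m.
exists (fun x y : T => @mdist R M x y); split.
- split.
  + exact: (@mdistxx R M).
  + exact: (@mdist_positivity R M).
  + exact: (@metric_sym R M).
  + by move=> y x z; exact: (@metric_triangle R M).
- by move=> U; rewrite -mo; exact: metric_openE.
- move=> u cu.
  have [l ul] : exists l : M, (fun n => u n : M) @ \oo --> l.
    apply: (mc (((fun n => u n : M)) @ \oo)).
    apply/cauchy_ballP => e e0; near_simpl.
    have [N uN] := cu e e0.
    exists ([set n | (N <= n)%N], [set n | (N <= n)%N]) => /=.
      by split; exists N.
    by move=> [a b] /= [Na Nb]; rewrite ballEmdist; exact: uN.
  exists l => e e0; have /cvg_ballP/(_ _ e0)[N _ uN] := ul.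
  exists N => n Nn; have := uN n Nn => /= /ball_sym.
  by rewrite ballEmdist.
Unshelve. all: by end_near. Qed.

(** An alias indexed by the proof that [d] is a distance, to which the metric of [d] can be attached
    without touching the structures of [T]. *)
Definition dist_space (T : choiceType) (d : T -> T ->
  R) (_ : is_dist d) : Type :=
  T.

Section DistSpace.
Variables (T : choiceType) (d : T -> T -> R) (dd : is_dist d).

HB.instance Definition _ := Choice.on (dist_space dd).

Let dxx : forall x : dist_space dd, d x x = 0. Proof. by case: dd. Qed.
Let dpos : forall x y : dist_space dd, d x y = 0 -> x = y.
Proof. by case: dd. Qed.
Let dsym : forall x y : dist_space dd, d x y = d y x. Proof. by case: dd. Qed.
Let dtri : forall y x z : dist_space dd, d x z <= d x y + d y z.
Proof. by case: dd. Qed.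

HB.instance Definition _ := isMetric.Build R (dist_space dd) dxx dpos dsym dtri.

End DistSpace.

Lemma dist_metric_topology (T : choiceType) (d : T -> T -> R) :
    is_dist d -> dist_complete d ->
    (exists2 D : set T, countable D &
       forall x (e : R), 0 < e -> exists2 y, D y & d x y < e) ->
  exists s : Topological T, let T' : topologicalType := Topological.Pack s in
    polish R T' /\ forall U, @open T' U <-> dist_open d U.
Proof.
move=> dd dc [D cD dD]; have [d0 dp ds dt] := dd.
pose M : metricType R := dist_space dd.
have oE (U : set M) : open U <-> dist_open d U by exact: metric_openE.
exists (Topological.class M) => /=; split; last exact: oE.
split.
  exists D => // U [x Ux] /oE oU; have [e e0 eU] := oU _ Ux.
  have [y Dy xy] := dD x e e0.
  by exists y; split => //; exact: eU.
exists (Metric.class M) => /=; split; first by [].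
move=> F PF /cauchy_ballP cF.
(* A Cauchy filter contains balls of every radius; their centres form a Cauchy sequence, whose limit
   is the limit of the filter. *)
have cn n : exists x : M, F (ball x n.+1%:R^-1).
  have [[P Q] /= [FP FQ] PQ] := cF _ (invS_gt0 n).
  have [x Px] := filter_ex FP.
  by exists x; apply: filterS FQ => y Qy; exact: (PQ (x, y)).
have {cn}[u uF] := choice cn.
have [l ul] : exists l, forall e : R, 0 < e ->
    exists N, forall n, (N <= n)%N -> d (u n) l < e.
  apply: dc => e e0; have [N Ne] := invS_lt (divr_gt0 e0 (ltr0Sn _ 1)).
  exists N => m n Nm Nn.
  have [x [/=]] := filter_ex (filterI (uF m) (uF n)).
  move=> xm xn.
  apply: (lt_halves (lt_trans (lt_le_trans xm (invS_le Nm)) Ne)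
                    (lt_trans (lt_le_trans xn (invS_le Nn)) Ne)).
  by rewrite [X in _ + X]ds; exact: dt.
exists (l : M) => P /= /(@nbhs_ballP R M l P)[e /= e0 eP].
have e2 := divr_gt0 e0 (ltr0Sn R 1).
have [N Ne] := invS_lt e2; have [N' ule] := ul _ e2.
apply: filterS (uF (maxn N N')) => y uy; apply: eP.
apply: (lt_halves (ule _ (leq_maxr N N'))
  (lt_trans (lt_le_trans uy (invS_le (leq_maxl N N'))) Ne)).
by rewrite [X in X + _]ds; exact: dt.
Unshelve. all: by end_near. Qed.

Lemma polish_distP (T : topologicalType) (x0 : T) : polish R T ->
  exists (d : T -> T -> R) (e : nat -> T),
    polish_dist d /\ forall x (eps : R), 0 < eps -> exists n, d x (e n) < eps.
Proof.
move=> [[D cD dD] /metric_polish_dist[d pd]].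
have [dd dO dc] := pd; have [d0 dp ds dt] := dd.
have /countable_injP[f fI] := cD.
have ex n : exists y, forall y', D y' -> f y' = n -> y = y'.
  have [[y [Dy fy]]|nD] := pselect (exists y, D y /\ f y = n).
    exists y => y' Dy' fy'; apply: fI; rewrite ?inE//; congruence.
  by exists x0 => y' Dy' fy'; exfalso; apply: nD; exists y'.
have [e eP] := choice ex; exists d, e; split=> // x eps eps0.
have [] := dD [set y | d x y < eps].
- by exists x; rewrite /= d0.
- apply/dO => y /= xy; exists (eps - d x y); first by rewrite subr_gt0.
  by move=> z yz; have := dt y x z; lra.
- by move=> y [/= xy Dy]; exists (f y); rewrite (eP _ y).
Qed.

Lemma polish_dist_hausdorff (T : topologicalType) (d : T -> T -> R) :
  polish_dist d -> forall x y : T, x <> y ->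
  exists U V : set T, [/\ open U, open V, U x, V y & U `&` V = set0].
Proof.
move=> [dd dO _] x y xy; have [d0 dp ds dt] := dd.
have e0 : 0 < d x y / 2.
  rewrite divr_gt0// lt_neqAle is_dist_ge0// andbT eq_sym.
  by apply/eqP => /dp.
have bO z e : open [set t | d z t < e].
  apply/dO => t /= zt; exists (e - d z t); first by rewrite subr_gt0.
  by move=> w tw; have := dt t z w; lra.
exists [set t | d x t < d x y / 2], [set t | d y t < d x y / 2].
split; rewrite /= ?d0//.
by rewrite -subset0 => t [/= xt yt]; have := dt t x y; rewrite (ds t y); lra.
Qed.

Lemma polish_base (T : topologicalType) (x0 : T) : polish R T ->
  exists U : nat -> set T, (forall i, open (U i)) /\
    forall x (V : set T), open V -> V x -> exists2 i, U i x & U i `<=` V.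
Proof.
move=> /(polish_distP x0)[d [e [[dd dO _] eD]]]; have [d0 dp ds dt] := dd.
pose U i := if unpickle i is Some (n, k) then [set y | d (e n) y < k.+1%:R^-1]
            else set0.
exists U; split.
  move=> i; rewrite /U; case: unpickle => [[n k]|]; last exact: open0.
  move: (k.+1%:R^-1) => r; apply/dO => t /= zt; exists (r - d (e n) t).
    by rewrite subr_gt0.
  by move=> w tw /=; have := dt t (e n) w; lra.
move=> x V /dO oV /oV[eps eps0 epsV].
have [k ke] := invS_lt (divr_gt0 eps0 (ltr0Sn R 1)).
have [n xn] := eD x _ (invS_gt0 k).
exists (pickle (n, k)); rewrite /U pickleK /=; first by rewrite ds.
move=> y /= ny; apply: epsV.
exact: (lt_halves (lt_trans xn ke) (lt_trans ny ke) (dt _ _ _)).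
Qed.

End Distance.

(** * Functions with closed graph and Borel sets *)

(** The graph of [z] is closed in the product of [T] with the product of discrete copies of [nat],
    where finite lists of coordinates give the basic neighbourhoods. *)
Definition closed_graph (J : eqType) (T : topologicalType) (z : T -> J -> nat) :
    Prop :=
  forall x w,
    (forall U : set T, open U -> U x -> forall F : seq J,
       exists2 y, U y & {in F, z y =1 w}) -> z x = w.

Definition recode (J : countType) (a : J -> nat) : nat -> nat :=
  fun n => if pickle_inv n is Some j then a j else 0.

Lemma recodeE (J : countType) (a : J -> nat) (j : J) :
  recode a (pickle j) = a j.
Proof. by rewrite /recode pickleK_inv. Qed.

Lemma closed_graph_recode (J : countType) (T : topologicalType)
  (z : T -> J -> nat) : closed_graph z -> closed_graph (fun x => recode (z x)).
Proof.
move=> cz x w xw.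
have zx : z x = w \o pickle.
  apply: cz => U oU Ux F; have [y Uy yF] := xw U oU Ux (map pickle F).
  by exists y => // j jF; rewrite -(recodeE (z y) j) yF// map_f.
apply/funext => n; rewrite /recode; case E : (pickle_inv n) => [j|].
  by rewrite zx /=; congr w; have := @pickle_invK J n; rewrite E.
have [y _ /(_ n)] := xw setT openT I [:: n].
by rewrite /recode E inE eqxx => /(_ isT).
Qed.

(* The sets that become clopen in a finer topology induced by a function with
   closed graph. *)
Definition clopenable (T : topologicalType) (P : set T) : Prop :=
  exists (z : T -> nat -> nat) (i : nat) (g : pred nat),
    closed_graph z /\ forall x, P x <-> g (z x i).

Lemma clopenableW (J : countType) (T : topologicalType) (P : set T)
    (z : T -> J -> nat) (j : J) (g : pred nat) :
  closed_graph z -> (forall x, P x <-> g (z x j)) -> clopenable P.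
Proof.
move=> cz zP; exists (fun x => recode (z x)), (pickle j), g; split.
  exact: closed_graph_recode.
by move=> x; rewrite recodeE.
Qed.

Definition least_code (Q : nat -> Prop) (k : nat) : Prop :=
  (k = 0 /\ forall n, ~ Q n) \/
  (exists n, [/\ k = n.+1, Q n & forall m, m < n -> ~ Q m]).

Lemma least_code_ex (Q : nat -> Prop) : exists k, least_code Q k.
Proof.
have [[n Qn]|nQ] := pselect (exists n, Q n); last first.
  by exists 0; left; split => // n Qn; apply: nQ; exists n.
have ex : exists n, `[< Q n >] by exists n; apply/asboolP.
case: (ex_minnP ex) => m /asboolP Qm mmin.
exists m.+1; right; exists m; split => // k km Qk.
by have := mmin k; rewrite asboolT// leqNgt km => /(_ isT).
Qed.

Lemma least_code_uniq (Q : nat -> Prop) (k l : nat) :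
  least_code Q k -> least_code Q l -> k = l.
Proof.
move=> [[-> nQ]|[n [-> Qn mn]]] [[-> nQ']|[m [-> Qm mm]]] //.
- by case: (nQ m).
- by case: (nQ' n).
- by case: (ltngtP n m) => [/mm//|/mn//|->].
Qed.

Lemma clopenableC (T : topologicalType) (P : set T) :
  clopenable P -> clopenable (~` P).
Proof.
move=> [z [i [g [cz zP]]]]; exists z, i, (predC g); split => // x /=.
by rewrite -(rwP negP); split => nP /zP.
Qed.

(** The functions for the [P n] are joined, and the code of the least [n] with [P n x] is added at
    [None]. The graph stays closed because each membership in [P n] can be read off one coordinate
    of the joined function, and memberships determine the code. The union is where the code is
    positive. *)
Lemma clopenable_bigcup (T : topologicalType) (P : nat -> set T) :
  (forall n, clopenable (P n)) -> clopenable (\bigcup_n P n).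
Proof.
move=> cP.
have /choice[zig zigP] : forall n,
  exists f : (T -> nat -> nat) * nat * pred nat,
    closed_graph f.1.1 /\ forall x, P n x <-> f.2 (f.1.1 x f.1.2).
  by move=> n; have [z [i [g [cz zP]]]] := cP n; exists (z, i, g).
have [k kP] := choice (fun x => least_code_ex (fun n => P n x)).
pose z x (j : option (nat * nat)) :=
  if j is Some (n, m) then (zig n).1.1 x m else k x.
apply: (@clopenableW _ _ _ z None (fun m => 0 < m)); last first.
  move=> x; rewrite /z; case: (kP x) => [[-> nP]|[n [-> Pn _]]]; split => //.
    by move=> [n _ /nP].
  by exists n.
move=> x w xw.
have zx n : (zig n).1.1 x = fun m => w (Some (n, m)).
  apply: (zigP n).1 => U oU Ux F.
  have [y Uy yF] := xw U oU Ux [seq Some (n, m) | m <- F].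
  by exists y => // m mF; rewrite -(yF (Some (n, m)))// map_f.
have PE (y : T) n : z y (Some (n, (zig n).1.2)) = w (Some (n, (zig n).1.2)) ->
    P n y <-> P n x.
  by rewrite (zigP n).2 [P n x](zigP n).2 zx /= => ->.
apply/funext => -[[n m]|]; first by rewrite /= zx.
apply: (least_code_uniq (kP x)).
case Ew : (w None) => [|n].
  left; split => // n /= Pn.
  have [y _ yF] := xw setT openT I [:: None; Some (n, (zig n).1.2)].
  have Pny : P n y by apply/(PE y n) => //; apply: yF; rewrite !inE eqxx orbT.
  have := yF None; rewrite inE eqxx Ew => /(_ isT) /= ky.
  case: (kP y) => [[_ /(_ n)]//|[m [] ]]; by rewrite ky.
right; exists n; split => //.
  have [y _ yF] := xw setT openT I [:: None; Some (n, (zig n).1.2)].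
  apply/(PE y n); first by apply: yF; rewrite !inE eqxx orbT.
  have := yF None; rewrite inE eqxx Ew => /(_ isT) /= ky.
  by case: (kP y) => [[]|[m []]]; rewrite ky// => -[->].
move=> m mn /= Pm.
have [y _ yF] := xw setT openT I [:: None; Some (m, (zig m).1.2)].
have Pmy : P m y by apply/(PE y m) => //; apply: yF; rewrite !inE eqxx orbT.
have := yF None; rewrite inE eqxx Ew => /(_ isT) /= ky.
by case: (kP y) => [[]|[m' [+ _ /(_ m)]]]; rewrite ky// => -[<-] /(_ mn).
Qed.

Lemma clopenable_preimage (T T' : topologicalType) (f : T -> T') (P : set T') :
  continuous f -> clopenable P -> clopenable (f @^-1` P).
Proof.
move=> cf [z [i [g [cz zP]]]]; exists (z \o f), i, g; split; last first.
  by move=> x; exact: zP.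
move=> x w xw; apply: cz => U oU Ufx F.
have [|y Uy yF] := xw (f @^-1` U) _ Ufx F; last by exists (f y).
by move/continuousP : cf; apply.
Qed.

Lemma clopenable_bigcap (T : topologicalType) (P : nat -> set T) :
  (forall n, clopenable (P n)) -> clopenable (\bigcap_n P n).
Proof.
move=> cP; rewrite -[X in clopenable X]setCK setC_bigcap.
by apply/clopenableC/clopenable_bigcup => n; exact: clopenableC.
Qed.

Lemma clopenableI (T : topologicalType) (P Q : set T) :
  clopenable P -> clopenable Q -> clopenable (P `&` Q).
Proof.
move=> cP cQ; rewrite -bigcap2E; apply: clopenable_bigcap => -[|[|n]] //=.
by exists (fun _ _ => 0), 0, predT; split => // x w xw; apply/funext => m;
  have [y _ /(_ m)] := xw setT openT I [:: m]; rewrite inE eqxx => ->.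
Qed.

(** * Open sets of a Polish space are clopenable *)

Section Refinement.
Variable R : realType.
Local Open Scope ring_scope.

(** Each step passes to the open neighbourhood of radius [n.+1%:R^-1] of the complement. An open set
    is the increasing union over [n] of the complements of these neighbourhoods. The neighbourhoods
    are open sets to be treated in turn, hence the indexing by finite sequences. *)
Fixpoint inner_open (T : Type) (d : T -> T -> R) (U : set T) (s : seq nat) :
    set T :=
  if s is n :: s' then
    [set x | exists2 y, ~ inner_open d U s' y & d x y < n.+1%:R^-1]
  else U.

(** The coordinate at [s] codes the least [n] for which [x] is in [V s] but outside [V (n :: s)].
    Being outside the open set [V (n :: s)] passes to limits; minimality of [n] passes to limits
    through the coordinates at [m :: s] for [m < n]. *)
Lemma clopenable_open (T : topologicalType) (d : T -> T -> R) (U : set T) :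
  polish_dist d -> open U -> clopenable U.
Proof.
move=> [[d0 _ ds dt] dO _] oU; pose V := inner_open d U.
have oV s : open (V s).
  case: s => // n s; apply/dO => x /= [y Vy xy].
  exists (n.+1%:R^-1 - d x y); first by rewrite subr_gt0.
  move=> t xt; exists y => //; have := dt x t y; rewrite (ds t x).
  by move: (n.+1%:R^-1) xy xt => r; lra.
have [z zP] := choice (fun xs : T * seq nat =>
  least_code_ex (fun n => V xs.2 xs.1 /\ ~ V (n :: xs.2) xs.1)).
have z0 x s : z (x, s) = 0%N -> ~ V s x.
  move=> zx Vx; case: (zP (x, s)) => [[_ /= nV]|[n []]]; last by rewrite zx.
  have /dO/(_ x Vx)[e e0 eV] := oV s.
  have [n ne] := invS_lt e0.
  by apply: (nV n); split => // -[y nVy xy]; apply/nVy/eV/(lt_trans xy).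
apply: (@clopenableW _ _ _ (fun x s => z (x, s)) [::] (fun n => 0 < n)%N).
  move=> x w xw.
  have wV s n : w s = n.+1 -> ~ V (n :: s) x.
    move=> ws Vx; have [y Vy /(_ s)] := xw _ (oV (n :: s)) Vx [:: s].
    rewrite inE eqxx => /(_ isT) zy.
    by case: (zP (y, s)) => [[]|[m []]]; rewrite zy ws// => -[<-] [].
  have wV1 s n : w s = n.+1 -> V s x.
    move=> /wV nV; apply: contrapT => nVx; apply: nV => /=.
    by exists x => //; rewrite d0 invS_gt0.
  apply/funext => s; apply: (least_code_uniq (zP (x, s))) => /=.
  case ws : (w s) => [|n].
    left; split => // n [Vx _]; have [y Vy /(_ s)] := xw _ (oV s) Vx [:: s].
    by rewrite inE eqxx ws => /(_ isT)/z0.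
  right; exists n; split => //.
    by split; [exact: wV1 ws|exact: wV].
  move=> m mn [Vx nVm]; case wm : (w (m :: s)) => [|k]; last exact/nVm/wV1/wm.
  have [y _ yF] := xw _ openT I [:: s; m :: s].
  have := yF s; rewrite inE eqxx ws => /(_ isT) zys.
  have := yF (m :: s); rewrite !inE eqxx orbT wm => /(_ isT) /z0 nVy.
  case: (zP (y, s)) => [[]|[k [+ [Vy _] /(_ m)]]]; rewrite zys// => -[<-].
  by move=> /(_ mn); apply; split.
move=> x; split => [Ux|].
  by rewrite lt0n; apply/negP => /eqP/z0; exact.
by case: (zP (x, [::])) => [[-> _]//|[n [_ [] ]]].
Qed.

End Refinement.

Lemma borel_clopenable (T : topologicalType) :
  (forall U : set T, open U -> clopenable U) ->
  forall P : set T, borel P -> clopenable P.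
Proof.
move=> oc P.
suff sc : sigma_algebra setT (@clopenable T) by exact: (smallest_sub sc oc).
split.
- exact/oc/open0.
- by move=> A cA; rewrite setTD; exact: clopenableC.
- by move=> A cA; exact: clopenable_bigcup.
Qed.

Lemma polish_borel_clopenable (R : realType) (T : topologicalType) (P : set T) :
  polish R T -> borel P -> clopenable P.
Proof.
move=> [_ /metric_polish_dist[d pd]]; apply: borel_clopenable => U.
exact: clopenable_open pd.
Qed.

(** Second countability makes an open set of the product a countable union of open rectangles, whose
    sides are pulled back along the projections; no distance on the product is needed. *)
Lemma polish_prod_borel_clopenable (R : realType) (X Y : topologicalType)
    (A : set (X * Y)) :
  polish R X -> polish R Y -> borel A -> clopenable A.
Proof.
move=> pX pY; have [[[x0 y0] _]|A0 bA] := pselect (exists p : X * Y, True).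
  apply: borel_clopenable => U oU.
  have [BX [oBX bBX]] := polish_base x0 pX.
  have [BY [oBY bBY]] := polish_base y0 pY.
  have dX := metric_polish_dist pX.2; have dY := metric_polish_dist pY.2.
  pose P n := if unpickle n is Some (i, j) then
    if `[< BX i `*` BY j `<=` U >] then BX i `*` BY j else set0 else set0.
  suff -> : U = \bigcup_n P n.
    apply: clopenable_bigcup => n; rewrite /P.
    have c0 : clopenable (@set0 (X * Y)).
      have [d pd] := dX.
      rewrite -(preimage_set0 (@fst X Y)); apply: clopenable_preimage.
        by move=> ?; exact: cvg_fst.
      exact: (clopenable_open pd open0).
    case: unpickle => [[i j]|//]; case: ifP => // _.
    have [d pd] := dX; have [d' pd'] := dY.
    have -> : BX i `*` BY j = (fst @^-1` BX i) `&` (snd @^-1` BY j) by [].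
    apply: clopenableI; apply: clopenable_preimage.
    + by move=> ?; exact: cvg_fst.
    + exact: (clopenable_open pd).
    + by move=> ?; exact: cvg_snd.
    + exact: (clopenable_open pd').
  apply/seteqP; split.
    move=> [x y] Uxy.
    have [[V W] /= [Vx Wy] VWU] : nbhs (x, y) U by exact: open_nbhs_nbhs.
    move: Vx Wy; rewrite !nbhsE => -[V' [oV' V'x] VV] [W' [oW' W'y] WW].
    have [i ix iV] := bBX x _ oV' V'x; have [j jy jW] := bBY y _ oW' W'y.
    exists (pickle (i, j)) => //; rewrite /P pickleK asboolT//.
    move=> [a b] /= [ai bj]; apply: VWU; split => /=.
      exact/VV/iV.
    exact/WW/jW.
  move=> p [n _]; rewrite /P; case: unpickle => [[i j]|//].
  by case: ifP => // /asboolP; apply.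
(* Here the product has no points, and a constant function serves. *)
exists (fun _ _ => 0), 0, predT; split => [p|p]; by case: A0; exists p.
Qed.

(** * Finer Polish topologies *)

Section FinerPolish.
Variable R : realType.
Local Open Scope ring_scope.

Lemma baire_dist_ex (ab : (nat -> nat) * (nat -> nat)) : exists r : R,
  (ab.1 = ab.2 /\ r = 0) \/
  (exists k, [/\ r = k.+1%:R^-1, ab.1 k <> ab.2 k &
                 forall i, (i < k)%N -> ab.1 i = ab.2 i]).
Proof.
have [n] := least_code_ex (fun k => ab.1 k <> ab.2 k).
move=> [[_ eqab]|[k [_ kab klt]]].
  by exists 0; left; split => //; apply/funext => i; apply: contrapT => /eqab.
exists k.+1%:R^-1; right; exists k; split => // i /klt.
exact: contrapT.
Qed.

Definition baire_dist (a b : nat -> nat) : R := sval (cid (baire_dist_ex (a,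
  b))).

Lemma baire_distP (a b : nat -> nat) :
  (a = b /\ baire_dist a b = 0) \/
  (exists k, [/\ baire_dist a b = k.+1%:R^-1, a k <> b k &
                 forall i, (i < k)%N -> a i = b i]).
Proof. exact: (svalP (cid (baire_dist_ex (a, b)))). Qed.

Lemma baire_dist_lt (a b : nat -> nat) (k : nat) :
  baire_dist a b < k.+1%:R^-1 <-> forall i, (i <= k)%N -> a i = b i.
Proof.
case: (baire_distP a b) => [[-> ->]|[n [-> nab nlt]]].
  by split => // _; exact: invS_gt0.
rewrite ltf_pV2 ?posrE ?ltr0n// ltr_nat ltnS; split => [kn i ik|kab].
  by apply: nlt; exact: leq_ltn_trans kn.
by rewrite ltnNge; apply/negP => nk; exact/nab/kab.
Qed.

Lemma baire_dist_ge0 (a b : nat -> nat) : 0 <= baire_dist a b.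
Proof. by case: (baire_distP a b) => [[_ ->]|[k [-> _ _]]]//;
  rewrite invr_ge0. Qed.

Lemma baire_dist_is_dist : is_dist baire_dist.
Proof.
split.
- by move=> a; case: (baire_distP a a) => [[]|[k []]].
- by move=> a b; case: (baire_distP a b) => [[]//|[k [-> _ _]]] /eqP;
  rewrite invr_eq0 pnatr_eq0.
- move=> a b; case: (baire_distP a b) => [[-> //]|[k [-> kab klt]]].
  case: (baire_distP b a) => [[ba]|[m [-> mba mlt]]];
    first by rewrite ba in kab.
  case: (ltngtP k m) => [/mlt/esym//|/klt/esym//|->//].
- move=> b a c; case: (baire_distP a c) => [[_ ->]|[k [-> kac klt]]].
    by rewrite addr_ge0// baire_dist_ge0.
  have := baire_dist_ge0 a b; have := baire_dist_ge0 b c.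
  have [/baire_dist_lt ab|] := ltP (baire_dist a b) k.+1%:R^-1; last first.
    by move=> h1 h2 h3; rewrite (le_trans h1)// lerDl.
  have [/baire_dist_lt bc|] := ltP (baire_dist b c) k.+1%:R^-1; last first.
    by move=> h1 h2 h3; rewrite (le_trans h1)// lerDr.
  by exfalso; apply: kac; rewrite ab// bc.
Qed.

(** The distance of the graph, [d] plus the Baire distance of the values of [z], is complete because
    the graph is closed: the limit of the values is the value at the limit. *)
Lemma closed_graph_polish (X : topologicalType) (x0 : X) (z : X -> nat -> nat) :
  polish R X -> closed_graph z ->
  exists s : Topological X, let X' : topologicalType := Topological.Pack s in
    [/\ polish R X', @open X `<=` @open X' &
        forall i n, @open X' [set x | z x i = n]].
Proof.
move=> /(polish_distP x0)[d [e [[dd dO dc] eD]]] cz.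
have [d0 dp ds dt] := dd; have [b0 bp bs bt] := baire_dist_is_dist.
pose d' x y := d x y + baire_dist (z x) (z y).
have dd' : is_dist d'.
  split.
  - by move=> x; rewrite /d' d0 b0 addr0.
  - move=> x y /eqP; rewrite /d' paddr_eq0 ?is_dist_ge0 ?baire_dist_ge0//.
    by move=> /andP[/eqP/dp].
  - by move=> x y; rewrite /d' ds bs.
  - by move=> y x t; rewrite /d' addrACA lerD.
have lel x y : d x y <= d' x y by rewrite lerDl baire_dist_ge0.
have ler x y : baire_dist (z x) (z y) <= d' x y by rewrite lerDr is_dist_ge0.
have dc' : dist_complete d'.
  move=> u cu.
  have [l ul] : exists l, forall e : R, 0 < e ->
      exists N, forall n, (N <= n)%N -> d (u n) l < e.
    apply: dc => r r0; have [N uN] := cu r r0; exists N => m n Nm Nn.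
    exact: le_lt_trans (lel _ _) (uN _ _ Nm Nn).
  have /choice[N NP] : forall k, exists N, forall m n,
    (N <= m)%N -> (N <= n)%N ->
      forall i, (i <= k)%N -> z (u m) i = z (u n) i.
    move=> k; have [N uN] := cu _ (invS_gt0 R k).
    exists N => m n Nm Nn; apply/baire_dist_lt.
    exact: le_lt_trans (ler _ _) (uN _ _ Nm Nn).
  (* Coordinates up to [i] are constant along the sequence from [N i] on, so [w] is the limit of the
     values of [z]. *)
  pose w i := z (u (N i)) i.
  have zw k n i : (N k <= n)%N -> (i <= k)%N -> z (u n) i = w i.
    move=> kn ik; rewrite (NP k n (maxn (N k) (N i)))// ?leq_maxl//.
    by rewrite (NP i _ (N i))// leq_maxr.
  have zl : z l = w.
    apply: cz => U /dO oU /oU[r r0 rU] F; have [M uM] := ul r r0.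
    exists (u (maxn M (N (\max_(i <- F) i)))).
      by apply: rU; rewrite ds; apply: uM; exact: leq_maxl.
    move=> i iF; apply: (zw _ _ _ (leq_maxr _ _)).
    by rewrite (big_rem _ iF) leq_maxl.
  exists l => r r0; have r2 := divr_gt0 r0 (ltr0Sn R 1).
  have [M uM] := ul _ r2; have [k kr] := invS_lt r2.
  exists (maxn M (N k)) => n; rewrite geq_max => /andP[Mn kn].
  apply: (lt_halves (uM n Mn) _ (lexx _)); apply: lt_trans kr.
  by apply/baire_dist_lt => i ik; rewrite zl; exact: zw kn ik.
have [] := dist_metric_topology dd' dc'.
  (* A countable dense set: one point, if there is any, for each centre, each radius and each finite
     initial segment of the values of [z]. *)
  have ex (c : nat * nat * seq nat) : exists y, forall x,
      d (e c.1.1) x < c.1.2.+1%:R^-1 -> (forall i,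
        (i < size c.2)%N -> z x i = nth 0%N c.2 i) ->
      d (e c.1.1) y < c.1.2.+1%:R^-1 /\ (forall i,
        (i < size c.2)%N -> z y i = nth 0%N c.2 i).
    have [[y yP]|nP] := pselect (exists y, d (e c.1.1) y < c.1.2.+1%:R^-1 /\
       (forall i, (i < size c.2)%N -> z y i = nth 0%N c.2 i)).
      by exists y.
    by exists x0 => x h1 h2; exfalso; apply: nP; exists x.
  have [y yP] := choice ex.
  exists (range y); first exact/(sub_countable (card_image_le _ _))/countableP.
  move=> x r r0; have r2 := divr_gt0 r0 (ltr0Sn R 1).
  (* Two steps of a quarter through the centre [e n] bound the first summand of [d'] by a half; the
     other half is for the second summand. *)
  have r4 := divr_gt0 r2 (ltr0Sn R 1).
  have [k kr] := invS_lt r4; have [n xn] := eD x _ (invS_gt0 R k).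
  have [t st tz] : exists2 t, size t = k.+1 &
      forall i, (i < k.+1)%N -> nth 0%N t i = z x i.
    by exists (mkseq (z x) k.+1); [exact: size_mkseq|move=> i;
      exact: nth_mkseq].
  exists (y (n, k, t)); first by exists (n, k, t).
  have [] := yP (n, k, t) x.
  + by rewrite ds.
  + by move=> i /=; rewrite st => /tz.
  move=> /= ny zy.
  apply: (@lt_halves _ (d x (y (n, k, t))) (baire_dist (z x) (z (y (n, k, t)))))
    => //.
    exact: (lt_halves (lt_trans xn kr) (lt_trans ny kr) (dt _ _ _)).
  apply: (@lt_trans _ _ k.+1%:R^-1).
    by apply/baire_dist_lt => i ik; rewrite zy ?st// tz.
  by apply: (lt_trans kr); rewrite ltr_pdivrMr// ltr_pMr// ltr1n.
move=> s /= [ps sO]; exists s; split => //.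
  move=> U /dO oU; apply/sO => x /oU[r r0 rU]; exists r => // y xy.
  by apply: rU; exact: le_lt_trans (lel _ _) xy.
move=> i n; apply/sO => x /= zx; exists i.+1%:R^-1; first exact: invS_gt0.
move=> y xy; have /baire_dist_lt : baire_dist (z x) (z y) < i.+1%:R^-1.
  exact: le_lt_trans (ler _ _) xy.
by move=> /(_ i (leqnn i)) <-.
Qed.

End FinerPolish.

Lemma clopenable_seq_polish (R : realType) (X : topologicalType) (x0 : X)
    (P : nat -> set X) :
  polish R X -> (forall n, clopenable (P n)) ->
  exists s : Topological X, let X' : topologicalType := Topological.Pack s in
    [/\ polish R X', @open X `<=` @open X' & forall n, @open X' (P n)].
Proof.
move=> pX cP.
have /choice[zig zigP] : forall n,
  exists f : (X -> nat -> nat) * nat * pred nat,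
    closed_graph f.1.1 /\ forall x, P n x <-> f.2 (f.1.1 x f.1.2).
  by move=> n; have [z [i [g [cz zP]]]] := cP n; exists (z, i, g).
pose z x (nm : nat * nat) := (zig nm.1).1.1 x nm.2.
have cz : closed_graph z.
  move=> x w xw; apply/funext => -[n m]; rewrite /z /=.
  rewrite ((zigP n).1 x (fun m => w (n, m)))// => U oU Ux F.
  have [y Uy yF] := xw U oU Ux [seq (n, m) | m <- F].
  by exists y => // k kF; rewrite -(yF (n, k))// map_f.
have [s /= [ps so sz]] := closed_graph_polish x0 pX (closed_graph_recode cz).
exists s; split => // n.
rewrite (_ : P n = \bigcup_(k in [set k | (zig n).2 k])
    [set x | recode (z x) (pickle (n, (zig n).1.2)) = k]); last first.
  apply/seteqP; split => x.
    move=> /(zigP n).2 gx; exists (z x (n, (zig n).1.2)) => //=.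
    exact: recodeE.
  move=> [k gk /=]; rewrite recodeE => zk; apply/(zigP n).2.
  by rewrite -zk in gk.
by apply: bigcup_open => k _; exact: sz.
Qed.

Lemma rectangles_potentially_closed (R : realType) (X Y : topologicalType)
    (x0 : X) (y0 : Y) (A : set (X * Y)) (P : nat -> set X) (Q : nat -> set Y) :
  polish R X -> polish R Y ->
  (forall n, clopenable (P n)) -> (forall n, clopenable (Q n)) ->
  ~` A = \bigcup_n (P n `*` Q n) -> potentially_closed R A.
Proof.
move=> pX pY cP cQ AE.
have [s /= [ps so sP]] := clopenable_seq_polish x0 pX cP.
have [t /= [pt to tQ]] := clopenable_seq_polish y0 pY cQ.
exists s, t; split => //.
rewrite -[A]setCK AE; apply: open_closedC; apply: bigcup_open => n _.
rewrite openE => -[x y] [/= Px Qy].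
exists (P n, Q n) => //=; split.
  exact: (@open_nbhs_nbhs (Topological.Pack s)).
exact: (@open_nbhs_nbhs (Topological.Pack t)).
Qed.

(** * Analytic sets *)

(** The index type is left free so that several codes can be kept as blocks of one function and
    selected by precomposition; [analyticW] returns to [nat]. *)
Definition baire_closed (J : eqType) (D : set (J -> nat)) : Prop :=
  forall a, (forall F : seq J, exists2 b, D b & {in F, a =1 b}) -> D a.

Definition baire_continuous (J : eqType) (T : topologicalType)
    (D : set (J -> nat)) (f : (J -> nat) -> T) : Prop :=
  forall a, D a -> forall U, open U -> U (f a) ->
  exists F : seq J, forall b, D b -> {in F, a =1 b} -> U (f b).

Definition open_separated (T : topologicalType) : Prop :=
  forall x y : T, x <> y ->
  exists U V : set T, [/\ open U, open V, U x, V y & U `&` V = set0].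

Definition analytic (T : topologicalType) (S : set T) : Prop :=
  exists (D : set (nat -> nat)) (f : (nat -> nat) -> T),
    [/\ baire_closed D, baire_continuous D f & S = f @` D].

Section BaireClosed.
Variable J : eqType.
Implicit Types D : set (J -> nat).

Lemma baire_closed_comp (J' : eqType) (p : J -> J') D :
  baire_closed D -> baire_closed [set c : J' -> nat | D (c \o p)].
Proof.
move=> cD a aD; apply: cD => F; have [b Db ab] := aD (map p F).
by exists (b \o p) => // j jF; apply: ab; rewrite map_f.
Qed.

Lemma baire_continuous_comp (J' : eqType) (T : topologicalType) (p : J -> J') D
    (f : (J -> nat) -> T) :
  baire_continuous D f ->
  baire_continuous [set c : J' -> nat | D (c \o p)] (fun c => f (c \o p)).
Proof.
move=> cf a Da U oU Ua; have [F FU] := cf _ Da U oU Ua.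
exists (map p F) => b Db ab; apply: FU => // j jF.
by apply: ab; rewrite map_f.
Qed.

Lemma baire_continuous_sub (T : topologicalType) D D' (f : (J -> nat) -> T) :
  D' `<=` D -> baire_continuous D f -> baire_continuous D' f.
Proof.
move=> sD cf a /sD Da U oU Ua; have [F FU] := cf _ Da U oU Ua.
by exists F => b /sD; exact: FU.
Qed.

Lemma baire_continuous_image (T T' : topologicalType) D (f : (J -> nat) -> T)
    (g : T -> T') :
  continuous g -> baire_continuous D f -> baire_continuous D (g \o f).
Proof.
move=> /continuousP cg cf a Da U oU Ua.
exact: (cf a Da (g @^-1` U) (cg U oU)).
Qed.

Lemma baire_continuous_pair (T T' : topologicalType) D (f : (J -> nat) -> T)
    (g : (J -> nat) -> T') :
  baire_continuous D f -> baire_continuous D g ->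
  baire_continuous D (fun c => (f c, g c)).
Proof.
move=> cf cg a Da U oU Ua.
have [[V W] /= [Vx Wy] VWU] : nbhs (f a, g a) U by exact: open_nbhs_nbhs.
move: Vx Wy; rewrite !nbhsE => -[V' [oV' V'x] VV] [W' [oW' W'y] WW].
have [F FV] := cf a Da V' oV' V'x; have [G GW] := cg a Da W' oW' W'y.
exists (F ++ G) => b Db ab; apply: VWU; split => /=.
  by apply/VV/FV => // j jF; apply: ab; rewrite mem_cat jF.
by apply/WW/GW => // j jG; apply: ab; rewrite mem_cat jG orbT.
Qed.

Lemma baire_closedI D D' :
  baire_closed D -> baire_closed D' -> baire_closed (D `&` D').
Proof.
move=> cD cD' a aD; split; [apply: cD|apply: cD'] => F;
by have [b [Db D'b] ab] := aD F; exists b.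
Qed.

Lemma baire_closed_forall (I : Type) (D : I -> set (J -> nat)) :
  (forall i, baire_closed (D i)) -> baire_closed [set c | forall i, D i c].
Proof.
by move=> cD a aD i; apply: cD => F; have [b Db ab] := aD F; exists b.
Qed.

Lemma baire_closed_imply (Q : Prop) D :
  (Q -> baire_closed D) -> baire_closed [set c | Q -> D c].
Proof.
move=> cD a aD q; apply: (cD q) => F; have [b Db ab] := aD F.
by exists b => //; exact: Db.
Qed.

Lemma baire_closed_eq (T : topologicalType) D (f g : (J -> nat) -> T) :
  open_separated T -> baire_closed D -> baire_continuous D f ->
  baire_continuous D g -> baire_closed [set c | D c /\ f c = g c].
Proof.
move=> sT cD cf cg a aD.
have Da : D a by apply: cD => F; have [b [Db _] ab] := aD F; exists b.
split => //; apply: contrapT => /sT[U [V [oU oV Ua Va UV]]].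
have [F FU] := cf a Da U oU Ua; have [G GV] := cg a Da V oV Va.
have [b [Db fg] ab] := aD (F ++ G).
suff : (U `&` V) (f b) by rewrite UV.
split; first by apply: FU => // j jF; apply: ab; rewrite mem_cat jF.
by rewrite fg; apply: GV => // j jG; apply: ab; rewrite mem_cat jG orbT.
Qed.

(** Storing the value of [z] in a block of the code turns membership in a clopenable set into a
    condition on a single coordinate. *)
Lemma baire_closed_graph (T : topologicalType) D (f : (J -> nat) -> T)
    (z : T -> nat -> nat) (p : nat -> J) :
  closed_graph z -> baire_closed D -> baire_continuous D f ->
  baire_closed [set c | D c /\ z (f c) = c \o p].
Proof.
move=> cz cD cf a aD.
have Da : D a by apply: cD => F; have [b [Db _] ab] := aD F; exists b.
split => //; apply: cz => U oU Ua F.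
have [G GU] := cf a Da U oU Ua.
have [b [Db zb] ab] := aD (G ++ map p F).
exists (f b); first by apply: GU => // j jG; apply: ab; rewrite mem_cat jG.
by move=> i iF; rewrite zb /= ab// mem_cat map_f ?orbT.
Qed.

Lemma baire_closed_coords (K : seq J) (P : set (seq nat)) :
  baire_closed [set c | P [seq c j | j <- K]].
Proof.
move=> a aD; have [b /= Pb ab] := aD K.
by rewrite (_ : map a K = map b K)//; apply/eq_in_map.
Qed.

End BaireClosed.

Lemma analyticW (J : countType) (T : topologicalType) (D : set (J -> nat))
    (f : (J -> nat) -> T) :
  baire_closed D -> baire_continuous D f -> analytic (f @` D).
Proof.
move=> cD cf; exists [set c : nat -> nat | D (c \o pickle)],
  (fun c : nat -> nat => f (c \o pickle)).
split; [exact: baire_closed_comp|exact: baire_continuous_comp|].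
have rK (c : J -> nat) : recode c \o pickle = c.
  by apply/funext => j; exact: recodeE.
apply/seteqP; split => x [c Dc <-]; first by exists (recode c); rewrite /= rK.
by exists (c \o pickle).
Qed.

Lemma analytic_image (T T' : topologicalType) (f : T -> T') (S : set T) :
  continuous f -> analytic S -> analytic (f @` S).
Proof.
move=> cf [D [g [cD cg ->]]]; exists D, (f \o g); split => //.
  exact: baire_continuous_image.
by rewrite image_comp.
Qed.

Lemma analytic_clopenable (T : topologicalType) (P : set T) :
  analytic (@setT T) -> clopenable P -> analytic P.
Proof.
move=> [D [f [cD cf Tf]]] [z [i [g [cz zP]]]].
pose D' := [set c : nat + nat -> nat | D (c \o inl)].
pose f' (c : nat + nat -> nat) := f (c \o inl).
have cD' : baire_closed D' by exact: baire_closed_comp.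
have cf' : baire_continuous D' f' by exact: baire_continuous_comp.
pose E := [set c | D' c /\ z (f' c) = c \o inr] `&`
  [set c : nat + nat -> nat | [set t | g (head 0 t)] [seq c j | j <- [:: inr
    i]]].
have -> : P = f' @` E.
  apply/seteqP; split.
    move=> x Px; have : (f @` D) x by rewrite -Tf.
    move=> [a Da ax].
    exists (fun j => match j with inl k => a k | inr k => z x k end) => //.
    by split=> /=; [split => //; rewrite /f' /= ax|apply/zP].
  by move=> x [c [[_ zc] /= gc] <-]; apply/zP; rewrite zc.
apply: analyticW.
  by apply: baire_closedI; [exact: baire_closed_graph|exact:
    baire_closed_coords].
by apply: baire_continuous_sub cf' => c [[]].
Qed.

Lemma analytic_prodT (X Y : topologicalType) :
  analytic (@setT X) -> analytic (@setT Y) -> analytic (@setT (X * Y)).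
Proof.
move=> [D [f [cD cf Tf]]] [E [g [cE cg Tg]]].
pose D' : set (nat + nat -> nat) :=
  [set c : nat + nat -> nat | D (c \o inl)] `&`
  [set c : nat + nat -> nat | E (c \o inr)].
have -> : @setT (X * Y) = (fun c : nat + nat -> nat => (f (c \o inl),
  g (c \o inr))) @` D'.
  apply/esym; rewrite -subTset => -[x y] _.
  have [a Da <-] : (f @` D) x by rewrite -Tf.
  have [b Eb <-] : (g @` E) y by rewrite -Tg.
  by exists (fun j => match j with inl k => a k | inr k => b k end).
apply: analyticW.
  by apply: baire_closedI; exact: baire_closed_comp.
apply: baire_continuous_pair.
  apply: baire_continuous_sub (baire_continuous_comp cf) => c [h _]; exact: h.
apply: baire_continuous_sub (baire_continuous_comp cg) => c [_ h]; exact: h.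
Qed.

Lemma polish_analytic (R : realType) (X : topologicalType) (x0 : X) :
  polish R X -> analytic (@setT X).
Proof.
move=> /(polish_distP x0)[d [e [[dd dO dc] eD]]].
have [d0 dp ds dt] := dd.
(* The codes are the sequences in the dense set with a prescribed rate of convergence. Each
   condition concerns two coordinates, so [D] is closed, and the uniform rate makes the limit
   continuous. *)
pose D := [set a : nat -> nat | forall mn : nat * nat,
  mn.1 <= mn.2 -> (d (e (a mn.1)) (e (a mn.2)) <= mn.1.+1%:R^-1)%R].
have ex (a : nat -> nat) : exists l, D a -> forall m,
  (d (e (a m)) l <= m.+1%:R^-1)%R.
  have [Da|] := pselect (D a); last by exists x0.
  have [l lP] : exists l, forall r : R, (0 < r)%R ->
      exists N, forall n, N <= n -> (d (e (a n)) l < r)%R.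
    apply: (dc (e \o a)) => r r0; have r2 := divr_gt0 r0 (ltr0Sn R 1).
    have [N Nr] := invS_lt r2; exists N => m n Nm Nn /=.
    have h k : N <= k -> (d (e (a N)) (e (a k)) < r / 2)%R.
      by move=> Nk; apply: le_lt_trans Nr; exact: (Da (N, k)).
    apply: (lt_halves (h _ Nm) (h _ Nn)).
    by rewrite [X in (_ <= X + _)%R]ds; exact: dt.
  exists l => _ m; apply/ler_addgt0Pr => r r0.
  have [N lN] := lP r r0.
  apply: (le_trans (dt (e (a (maxn m N))) _ _)); apply: lerD.
    by apply: (Da (m, maxn m N)); exact: leq_maxl.
  by apply: ltW; apply: lN; exact: leq_maxr.
have [f fP] := choice ex.
exists D, f; split.
- apply: baire_closed_forall => -[m n] /=.
  apply: baire_closed_imply => _.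
  have := @baire_closed_coords nat [:: m; n]
    [set t | (d (e (nth 0 t 0)) (e (nth 0 t 1)) <= m.+1%:R^-1)%R].
  exact.
- move=> a Da U /dO oU /oU[r r0 rU].
  have r2 := divr_gt0 r0 (ltr0Sn R 1); have [m mr] := invS_lt r2.
  exists [:: m] => b Db ab; apply: rU.
  have am : a m = b m by apply: ab; rewrite inE.
  apply: (lt_halves (le_lt_trans (fP a Da m) mr) (le_lt_trans (fP b Db m) mr)).
  by rewrite -am [X in (_ <= X + _)%R]ds; exact: dt.
- apply/esym; rewrite -subTset => x _.
  (* Half the radius, so that the triangle inequality through [x] gives the bound required by
     [D]. *)
  have /choice[a aP] : forall n, exists k, (d x (e k) < n.+1%:R^-1 / 2)%R.
    by move=> n; apply: eD; rewrite divr_gt0// invS_gt0.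
  have Da : D a.
    move=> [m n] /= mn; apply: ltW; apply: (lt_halves (aP m)).
      apply: (lt_le_trans (aP n)).
      by rewrite ler_pM2r ?invr_gt0//; exact: invS_le.
    by rewrite [X in (_ <= X + _)%R]ds; exact: dt.
  exists a => //; apply/dp/eqP; rewrite eq_le is_dist_ge0// andbT.
  apply/ler_addgt0Pr => r r0; rewrite add0r.
  have r2 := divr_gt0 r0 (ltr0Sn R 1); have [m mr] := invS_lt r2.
  apply: ltW; apply: (lt_halves (le_lt_trans (fP a Da m) mr)).
    apply: (lt_trans _ mr); apply: (lt_le_trans (aP m)).
    by rewrite ler_pdivrMr// ler_peMr ?ler1n// ltW// invS_gt0.
  by rewrite [X in (_ <= X + _)%R]ds [X in (_ <= _ + X)%R]ds; exact: dt.
Qed.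

(** * Separation *)

Lemma borel_open (T : topologicalType) (U : set T) : open U -> borel U.
Proof. exact: sub_sigma_algebra. Qed.

Lemma borel0 (T : topologicalType) : borel (@set0 T).
Proof. by apply: borel_open; exact: open0. Qed.

Lemma borelC (T : topologicalType) (P : set T) : borel P -> borel (~` P).
Proof.
by case: (@smallest_sigma_algebra T setT open) => _ + _; rewrite -setTD; exact.
Qed.

Lemma borel_bigcup (T : topologicalType) (P : nat -> set T) :
  (forall n, borel (P n)) -> borel (\bigcup_n P n).
Proof. by case: (@smallest_sigma_algebra T setT open) => _ _; exact. Qed.

Lemma borel_bigcap (T : topologicalType) (P : nat -> set T) :
  (forall n, borel (P n)) -> borel (\bigcap_n P n).
Proof.
move=> bP; rewrite -[X in borel X]setCK setC_bigcap.
by apply: borelC; apply: borel_bigcup => n; exact: borelC.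
Qed.

Lemma borel_preimage (T T' : topologicalType) (f : T -> T') (P : set T') :
  continuous f -> borel P -> borel (f @^-1` P).
Proof.
move=> /continuousP cf; move: P.
have sa : sigma_algebra setT [set P : set T' | borel (f @^-1` P)].
  split => /=.
  - by rewrite preimage_set0; exact: borel0.
  - by move=> P bP; rewrite setTD preimage_setC; exact: borelC.
  - by move=> P bP; rewrite preimage_bigcup; exact: borel_bigcup.
suff op : @open T' `<=` [set P | borel (f @^-1` P)].
  by move=> P; exact: (smallest_sub sa op).
by move=> U oU; apply: borel_open; exact: cf.
Qed.

Definition borel_separated (T : topologicalType) (S S' : set T) : Prop :=
  exists P, [/\ borel P, S `<=` P & P `<=` ~` S'].

Lemma borel_separated_bigcup (T : topologicalType) (S S' : nat -> set T) :
  (forall m n, borel_separated (S m) (S' n)) ->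
  borel_separated (\bigcup_n S n) (\bigcup_n S' n).
Proof.
move=> sepS.
have /choice[P PP] : forall mn : nat * nat, exists P,
    [/\ borel P, S mn.1 `<=` P & P `<=` ~` S' mn.2].
  by move=> [m n]; exact: sepS.
exists (\bigcup_m \bigcap_n P (m, n)); split.
- apply: borel_bigcup => m; apply: borel_bigcap => n.
  by have [] := PP (m, n).
- by move=> x [m _ Smx]; exists m => // n _; have [_ + _] := PP (m, n); apply.
- move=> x [m _ Px] [n _ S'nx]; have [_ _] := PP (m, n).
  by move=> /(_ x (Px n I)); apply.
Qed.

Definition cylinder (s : seq nat) : set (nat -> nat) :=
  [set a | forall i, i < size s -> a i = nth 0 s i].

Lemma cylinder_rcons (s : seq nat) :
  cylinder s = \bigcup_n cylinder (rcons s n).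
Proof.
apply/seteqP; split => a.
  move=> sa; exists (a (size s)) => // i; rewrite size_rcons ltnS nth_rcons.
  by rewrite leq_eqVlt; case: ltngtP => //= [/sa//|->].
move=> [n _ sa] i si; rewrite sa; last by rewrite size_rcons ltnS ltnW.
by rewrite nth_rcons si.
Qed.

Lemma cylinder_mkseq (a b : nat -> nat) (k : nat) :
  cylinder (mkseq a k) b -> forall i, i < k -> a i = b i.
Proof.
by move=> kb i ik; rewrite kb ?size_mkseq// nth_mkseq.
Qed.

Lemma cylinder_seq (a b : nat -> nat) (F : seq nat) (k : nat) :
  \max_(i <- F) i < k -> cylinder (mkseq a k) b -> {in F, a =1 b}.
Proof.
move=> Fk kb i iF; apply: (cylinder_mkseq kb); apply: leq_ltn_trans Fk.
by rewrite (big_rem _ iF) leq_maxl.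
Qed.

(* Lusin's separation theorem. If two pieces cannot be separated, neither can
   some pair of subpieces; iterating yields points whose images coincide. *)
Lemma analytic_separation (T : topologicalType) (S S' : set T) :
  open_separated T -> analytic S -> analytic S' -> S `<=` ~` S' ->
  borel_separated S S'.
Proof.
move=> sT [D [f [cD cf ->]]] [D' [f' [cD' cf' ->]]] dis.
pose bad (p : seq nat * seq nat) :=
  ~ borel_separated (f @` (D `&` cylinder p.1)) (f' @` (D' `&` cylinder p.2)).
have /choice[next nextP] : forall p, exists mn, bad p ->
    bad (rcons p.1 mn.1, rcons p.2 mn.2).
  move=> p; have [bp|] := pselect (bad p); last by exists (0, 0).
  apply: contrapT => /forallNP np; apply: bp.
  rewrite (cylinder_rcons p.1) (cylinder_rcons p.2) !setI_bigcupr !image_bigcup.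
  apply: borel_separated_bigcup => m n.
  by apply: contrapT => nS; apply: (np (m, n)) => _.
apply: contrapT => nsep.
pose p := fix p k :=
  if k is k'.+1 then (rcons (p k').1 (next (p k')).1,
                      rcons (p k').2 (next (p k')).2)
  else ([::], [::]).
have badp k : bad (p k).
  elim: k => [|k IH]; last exact: nextP.
  have c0 : cylinder [::] = setT by apply/seteqP; split.
  by rewrite /bad /= c0 !setIT.
pose a i := (next (p i)).1; pose b i := (next (p i)).2.
have pE k : p k = (mkseq a k, mkseq b k).
  by elim: k => // k IH; rewrite !mkseqS /= -/p {1 3}IH.
have bad_k k : bad (mkseq a k, mkseq b k) by rewrite -pE.
have ltF (F : seq nat) : \max_(i <- F) i < (\max_(i <- F) i).+1 by [].
(* Otherwise some cylinder around [a] misses [D], the corresponding piece is empty, and the empty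
   set separates it. For [b] the whole space does. *)
have Da : D a.
  apply: cD => F; apply: contrapT => nF; apply: (bad_k (\max_(i <- F) i).+1).
  exists set0; split => //; first exact: borel0.
  move=> _ [x [Dx kx] <-]; apply: nF; exists x => //.
  exact: cylinder_seq (ltF F) kx.
have D'b : D' b.
  apply: cD' => F; apply: contrapT => nF; apply: (bad_k (\max_(i <- F) i).+1).
  exists setT; split => //; first by (apply: borel_open; exact: openT).
  move=> y _ [x [Dx kx] _]; apply: nF; exists x => //.
  exact: cylinder_seq (ltF F) kx.
have [fab|/sT[U [V [oU oV Ua Vb UV]]]] := pselect (f a = f' b).
  by apply: (dis (f a)); [exists a|exists b].
have [F FU] := cf a Da U oU Ua; have [G GV] := cf' b D'b V oV Vb.
apply: (bad_k (maxn (\max_(i <- F) i) (\max_(i <- G) i)).+1).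
exists U; split; first exact: borel_open.
  move=> _ [x [Dx kx] <-]; apply: FU => //; apply: cylinder_seq kx.
  by rewrite ltnS leq_maxl.
move=> y Uy [x [Dx kx] fx]; have : (U `&` V) y; last by rewrite UV.
split => //; rewrite -fx; apply: GV => //; apply: cylinder_seq kx.
by rewrite ltnS leq_maxr.
Qed.

Lemma analytic_fiber_image (X Y : topologicalType) (A : set (X * Y)) (Q : set
  Y) :
  open_separated Y -> analytic A -> analytic Q ->
  analytic [set x | exists2 y, Q y & A (x, y)].
Proof.
move=> sY [D [f [cD cf AE]]] [E [g [cE cg QE]]].
pose D' := [set c : nat + nat -> nat | D (c \o inl)] `&`
           [set c : nat + nat -> nat | E (c \o inr)].
have cD' : baire_closed D' by apply: baire_closedI; exact: baire_closed_comp.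
have cf' : baire_continuous D' (fun c : nat + nat -> nat => f (c \o inl)).
  by apply: baire_continuous_sub (baire_continuous_comp cf) => c [].
have cg' : baire_continuous D' (fun c : nat + nat -> nat => g (c \o inr)).
  by apply: baire_continuous_sub (baire_continuous_comp cg) => c [].
have c1 : continuous (@fst X Y) by move=> ?; exact: cvg_fst.
have c2 : continuous (@snd X Y) by move=> ?; exact: cvg_snd.
rewrite (_ : [set x | _] = (fun c : nat + nat -> nat => (f (c \o inl)).1) @`
  [set c | D' c /\ (f (c \o inl)).2 = g (c \o inr)]).
  apply: analyticW.
    apply: (baire_closed_eq sY cD') => //.
    exact: (baire_continuous_image c2 cf').
  apply: baire_continuous_sub (baire_continuous_image c1 cf') => c [h _].
  exact: h.
rewrite AE QE; apply/seteqP; split => x.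
  move=> [_ [b Eb <-] [a Da fa]].
  exists (fun j => match j with inl k => a k | inr k => b k end).
    by split => //=; rewrite fa.
  by rewrite /= fa.
move=> [c [[/= Dc Ec] fg] <-]; exists (g (c \o inr));
  first by exists (c \o inr).
by exists (c \o inl) => //; rewrite -fg -surjective_pairing.
Qed.

(** Lusin separation is used twice: [P] is separated from the projection of the part of [A] over
    [Q], and then [Q] from the projection of the part of [A] over the Borel set [P'] just found. *)
Lemma analytic_rectangle_separation (R : realType) (X Y : topologicalType)
    (x0 : X) (A : set (X * Y)) (P : set X) (Q : set Y) :
  polish R X -> open_separated X -> open_separated Y -> analytic A ->
    analytic P ->
  analytic Q -> P `*` Q `<=` ~` A ->
  exists (P' : set X) (Q' : set Y), [/\ borel P', borel Q', P `<=` P',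
    Q `<=` Q' &
    P' `*` Q' `<=` ~` A].
Proof.
move=> pX sX sY aA aP aQ PQ.
have [P' [bP' PP' P'Q]] := analytic_separation sX aP
  (analytic_fiber_image sY aA aQ)
  (fun x Px hx => let: ex_intro2 y Qy Axy := hx in PQ (x, y) (conj Px Qy) Axy).
have aP' : analytic P'.
  exact: (analytic_clopenable (polish_analytic x0 pX) (polish_borel_clopenable
    pX bP')).
have cs : continuous (fun p : X * Y => (p.2, p.1)).
  by move=> p; apply: cvg_pair; [exact: cvg_snd|exact: cvg_fst].
have aAs : analytic ((fun p : X * Y => (p.2,
  p.1)) @` A) by exact: analytic_image.
have [|Q' [bQ' QQ' Q'P]] := analytic_separation sY aQ (analytic_fiber_image sX
  aAs aP').
  move=> y Qy [x P'x [[x' y'] Axy [? ?]]]; subst x' y'.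
  by apply: (P'Q x P'x); exists y.
exists P', Q'; split => // -[x y] [/= P'x Q'y] Axy.
by apply: (Q'P y Q'y); exists x => //; exists (x, y).
Qed.

(** Suslin's argument: the identity is continuous from the finer topology, so [U] and its complement
    are both analytic in the coarser one, and a Borel set separating them is [U] itself. *)
Lemma finer_polish_open_borel (R : realType) (X : topologicalType) (x0 : X)
    (s : Topological X) :
  let X' : topologicalType := Topological.Pack s in
  polish R X' -> open_separated X -> @open X `<=` @open X' ->
  forall U, @open X' U -> @borel X U.
Proof.
move=> X' pX' sX oo U oU.
have cid' : continuous (id : X' -> X) by apply/continuousP => V; exact: oo.
have aT : analytic (@setT X') by exact: (@polish_analytic R X' x0).
have cU : clopenable (U : set X').
  by apply: (polish_borel_clopenable pX'); exact: borel_open.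
have aU : @analytic X U.
  by have := analytic_image cid' (analytic_clopenable aT cU); rewrite image_id.
have aU' : @analytic X (~` U).
  have := analytic_image cid' (analytic_clopenable aT (clopenableC cU)).
  by rewrite image_id.
have [|P [bP UP PU]] := analytic_separation sX aU aU'; first by rewrite setCK.
rewrite (_ : U = P)//; apply/seteqP; split => //.
by rewrite setCK in PU.
Qed.

(** * The Cantor space *)

Lemma cantor_nbhsP (al : cantor_space) (U : set cantor_space) :
  nbhs al U <->
  exists n, forall be : cantor_space, (forall i, i < n -> be i = al i) -> U be.
Proof.
split; last first.
  have Fal : Filter (nbhs (al : cantor_space)) by exact: nbhs_filter.
  move=> [n nU]; apply: (@filterS _ _ Fal _ _ nU).
  elim: n {nU} => [|n IH].
    by apply: (@filterS _ _ Fal setT) => //; exact: filterT.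
  have bn : nbhs (al : cantor_space) [set be | be n = al n].
    apply: (@proj_continuous nat (fun=> bool) n al [set b | b = al n]).
    exact: (@discrete_set1 bool (al n)).
  apply: (@filterS _ _ Fal _ _ _ (@filterI _ _ Fal _ _ IH bn)) => be [ben bea]
    i.
  by rewrite ltnS leq_eqVlt => /orP[/eqP->|/ben].
(* The filter generated by the cylinders around [al] converges to [al] coordinatewise, hence in the
   product topology. *)
pose G := filter_from [set: nat]
  (fun n => [set be : cantor_space | forall i, i < n -> be i = al i]).
have FG : Filter G.
  apply: filter_from_filter; first by exists 0.
  move=> m n _ _; exists (maxn m n) => // be beP; split => i ilt; apply: beP;
  by rewrite leq_max ilt ?orbT.
have Gal : G --> al.
  apply/(@pointwise_cvgP nat bool G al) => i P /= Pi;
    exists i.+1 => // be /= beP.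
  by rewrite beP//; exact: nbhs_singleton.
by move=> /Gal[n _ nU]; exists n.
Qed.

Lemma cantor_continuousP (T : topologicalType) (u : cantor_space -> T) :
  continuous u <-> forall (al : cantor_space) (U : set T), open U -> U (u al) ->
    exists n, forall be : cantor_space,
      (forall i, i < n -> be i = al i) -> U (u be).
Proof.
split.
  move=> cu al U oU Ual; apply/(cantor_nbhsP al (u @^-1` U)).
  by apply: cu; exact: open_nbhs_nbhs.
move=> cu al U; rewrite nbhsE => -[V [oV Val] VU].
apply/(cantor_nbhsP al (u @^-1` U)).
by have [n nV] := cu al V oV Val; exists n => be /nV/VU.
Qed.

(** With the leading 1 restored, [psi n] is the binary expansion of [n.+1]; appending [b] gives
    [n.+1.*2 + b], the successor of the index on the left. *)
Lemma psi_rcons (n : nat) (b : bool) : psi (n.*2.+1 + b) = rcons (psi n) b.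
Proof.
have e : (n.*2.+1 + b).+1 = (n.+1).*2 + b by rewrite doubleS !addSn.
have h : (n.+1.*2 + b)./2 = n.+1 by rewrite addnC half_bit_double.
have l : trunc_log 2 (n.+1.*2 + b) = (trunc_log 2 n.+1).+1.
  by rewrite trunc_log2S ?h// -addnn addSn addnS.
rewrite /psi e l mkseqS; congr rcons.
  apply/eq_in_map => i; rewrite mem_iota add0n => /= ilt.
  rewrite subSS -[trunc_log 2 n.+1 - i]prednK ?subn_gt0//.
  by rewrite expnS divnMA divn2 h -subnS.
by rewrite subnn expn0 divn1 oddD odd_double; case: b {e h l}.
Qed.

Lemma psi_surj (s : seq bool) : exists n, psi n = s.
Proof.
elim/last_ind: s => [|s b [n <-]]; first by exists 0.
by exists (n.*2.+1 + b); exact: psi_rcons.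
Qed.

(** Take [n] with [psi n] the first [N] digits of [al]: the padding starts only after them, and
    [N <= n] because [psi n] has length at most [n]. *)
Lemma sseq_dense (al : nat -> bool) (N : nat) :
  exists2 n, N <= n & forall i, i < N -> nth false (sseq n) i = al i.
Proof.
have [n nE] := psi_surj (mkseq al N).
have sn : size (psi n) = N by rewrite nE size_mkseq.
exists n; first by rewrite -sn; exact: size_psi_le.
by move=> i iN; rewrite /sseq nth_cat sn iN nE nth_mkseq.
Qed.

Lemma prepend_lt (s : seq bool) (b : bool) (g : cantor_space) (i : nat) :
  i < size s -> prepend (rcons s b) g i = nth false s i.
Proof.
move=> si; rewrite /prepend (set_nth_default false).
  by rewrite nth_rcons si.
by rewrite size_rcons ltnS ltnW.
Qed.

Lemma prepend_size (s : seq bool) (b : bool) (g : cantor_space) :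
  prepend (rcons s b) g (size s) = b.
Proof.
rewrite /prepend (set_nth_default false).
  by rewrite nth_rcons ltnn eqxx.
by rewrite size_rcons.
Qed.

Lemma prepend_gt (s : seq bool) (b : bool) (g : cantor_space) (i : nat) :
  size s < i -> prepend (rcons s b) g i = g (i - (size s).+1).
Proof. by move=> si; rewrite /prepend nth_default size_rcons. Qed.

Lemma A0P (a b : cantor_space) : A0 (a, b) <-> exists n,
  [/\ forall i, i < n -> a i = nth false (sseq n) i, a n = false, b n = true &
      forall i, i != n -> a i = b i].
Proof.
split.
  move=> [n [g [-> ->]]]; exists n; split.
  - by move=> i ni; rewrite prepend_lt// size_sseq.
  - by rewrite -[X in prepend _ _ X](size_sseq n) prepend_size.
  - by rewrite -[X in prepend _ _ X](size_sseq n) prepend_size.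
  - move=> i; case: (ltngtP i n) => // ni _.
      by rewrite !prepend_lt// size_sseq.
    by rewrite !prepend_gt// size_sseq.
move=> [n [an a0 b1 ab]]; exists n, (fun i => a (i + n.+1)).
suff E (c : cantor_space) : (forall i, i != n -> a i = c i) ->
    c = prepend (rcons (sseq n) (c n)) (fun i => a (i + n.+1)).
  by rewrite {1}(E a)// {1}(E b)// a0 b1.
move=> ac; apply/funext => i; case: (ltngtP i n) => ni.
- by rewrite prepend_lt ?size_sseq// -an// ac// ltn_eqF.
- by rewrite prepend_gt ?size_sseq// subnK// -ac// gtn_eqF.
- by rewrite ni -[X in prepend _ _ X](size_sseq n) prepend_size.
Qed.

Lemma A0_irrefl (a : cantor_space) : ~ A0 (a, a).
Proof. by move=> /A0P[n [_ -> ]]. Qed.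

(** The diagonal is in the closure by density of the [sseq n]. If [a k <> b k], an edge close to
    [(a, b)] differs at [k], hence only there; it is then an edge at the node [sseq k], and this
    passes to the limit. *)
Lemma closure_A0P (a b : cantor_space) :
  closure A0 (a, b) <-> A0 (a, b) \/ a = b.
Proof.
have clE : closure A0 (a, b) <-> forall N, exists a' b' : cantor_space,
    [/\ A0 (a', b'), forall i, i < N -> a' i = a i & forall i,
      i < N -> b' i = b i].
  split.
    pose C (c : cantor_space) N : set cantor_space :=
      [set c' | forall i, i < N -> c' i = c i].
    move=> cl N; have [|] := cl (C a N `*` C b N).
      by exists (C a N, C b N) => //; split; apply/cantor_nbhsP; exists N.
    by move=> [a' b'] [Aab [/= ? ?]]; exists a', b'.
  move=> cl B [[U V] /= [/cantor_nbhsP[m mU] /cantor_nbhsP[n nV]] UVB].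
  have [a' [b' [Aab aP bP]]] := cl (maxn m n).
  exists (a', b'); split => //; apply: UVB; split => /=.
    by apply: mU => i im; apply: aP; rewrite leq_max im.
  by apply: nV => i im; apply: bP; rewrite leq_max im orbT.
rewrite clE; split; last first.
  move=> [Aab|<-] N; first by exists a, b.
  have [n Nn nP] := sseq_dense a N.
  exists (prepend (rcons (sseq n) false) a), (prepend (rcons (sseq n) true) a).
  split; first by exists n, a.
    by move=> i iN; rewrite prepend_lt ?nP// size_sseq (leq_trans iN).
  by move=> i iN; rewrite prepend_lt ?nP// size_sseq (leq_trans iN).
move=> cl; have [ab|ab] := pselect (a = b); first by right.
left; have [k kab] : exists k, a k <> b k.
  by apply: contrapT => /forallNP h; apply/ab/funext => i;
    apply: contrapT => /h.
have clk N : k < N -> exists a' b' : cantor_space,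
    [/\ forall i, i < N -> a' i = a i, forall i, i < N -> b' i = b i &
    [/\ forall i, i < k -> a' i = nth false (sseq k) i, a' k = false,
      b' k = true &
      forall i, i != k -> a' i = b' i]].
  move=> kN; have [a' [b' [/A0P[n nP] aP bP]]] := cl N.
  have [E|nk] := eqVneq k n; first by subst n; exists a', b'.
  by case: nP => _ _ _ /(_ k nk); rewrite aP// bP// => /kab.
apply/A0P; exists k; split.
- move=> i ik; have [a' [b' [aP _ [kP _ _ _]]]] := clk k.+1 (leqnn _).
  by rewrite -aP ?kP// ltnS ltnW.
- have [a' [b' [aP _ [_ kP _ _]]]] := clk k.+1 (leqnn _).
  by rewrite -aP.
- have [a' [b' [_ bP [_ _ kP _]]]] := clk k.+1 (leqnn _).
  by rewrite -bP.
- move=> i ik; have [] := clk (maxn k i).+1; first by rewrite ltnS leq_maxl.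
  by move=> a' [b' [aP bP [_ _ _ /(_ i ik)]]]; rewrite aP ?bP// ltnS leq_maxr.
Qed.

Lemma reductionP (X Y : Type) (A : set (X * Y)) (u : cantor_space -> X)
    (v : cantor_space -> Y) :
  A0 = [set p | A (u p.1, v p.2)] `&` closure A0 <->
  (forall al, ~ A (u al, v al)) /\ (forall a b, A0 (a, b) -> A (u a, v b)).
Proof.
split.
  move=> E; split.
    move=> al Aal; apply: (@A0_irrefl al); rewrite E; split => //.
    by apply/closure_A0P; right.
  by move=> a b; rewrite E => -[].
move=> [nA AA]; apply/seteqP; split => -[a b].
  by move=> Aab; split; [exact: AA|apply/closure_A0P; left].
by move=> [/= Aab /closure_A0P[//|E]]; subst b; case: (nA a).
Qed.

(** * The dichotomy *)

Definition rectangle_union (X Y : topologicalType) (W : set (X * Y)) : Prop :=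
  exists (P : nat -> set X) (Q : nat -> set Y),
    [/\ forall n, borel (P n), forall n, borel (Q n) &
        W = \bigcup_n (P n `*` Q n)].

Lemma rectangle_union_bigcup (X Y : topologicalType) (W : nat -> set (X * Y)) :
  (forall n, rectangle_union (W n)) -> rectangle_union (\bigcup_n W n).
Proof.
move=> rW.
have /choice[P' PP] : forall n, exists PQ : (nat -> set X) * (nat -> set Y),
    [/\ forall n, borel (PQ.1 n), forall n, borel (PQ.2 n) &
        W n = \bigcup_k (PQ.1 k `*` PQ.2 k)].
  by move=> n; have [P [Q [bP bQ WE]]] := rW n; exists (P, Q).
exists (fun n => if unpickle n is Some (i, j) then (P' i).1 j else set0).
exists (fun n => if unpickle n is Some (i, j) then (P' i).2 j else set0).
split.
- move=> n; case: unpickle => [[i j]|]; last exact: borel0.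
  by have [] := PP i.
- move=> n; case: unpickle => [[i j]|]; last exact: borel0.
  by have [] := PP i.
- apply/seteqP; split => p.
    move=> [i _]; have [_ _ ->] := PP i; move=> [j _ Pj].
    by exists (pickle (i, j)) => //; rewrite pickleK.
  move=> [n _]; case: unpickle => [[i j] Pij|[]//].
  by exists i => //; have [_ _ ->] := PP i; exists j.
Qed.

Lemma rectangle_union0 (X Y : topologicalType) : rectangle_union (@set0 (X *
  Y)).
Proof.
exists (fun=> set0), (fun=> set0); split; do ?by move=> n; exact: borel0.
by apply/esym; rewrite -subset0 => p [n _ []].
Qed.

Lemma rectangle_union1 (X Y : topologicalType) (P : set X) (Q : set Y) :
  borel P -> borel Q -> rectangle_union (P `*` Q).
Proof.
move=> bP bQ; exists (fun=> P), (fun=> Q); split => //.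
by apply/seteqP; split => [p Pp|p [n _]//]; exists 0.
Qed.

Lemma rectangle_union_clopenable (R : realType) (X Y : topologicalType)
    (W : set (X * Y)) :
  polish R X -> polish R Y -> rectangle_union W -> clopenable W.
Proof.
move=> pX pY [P [Q [bP bQ ->]]]; apply: clopenable_bigcup => n.
have -> : P n `*` Q n = (fst @^-1` P n) `&` (snd @^-1` Q n) by [].
apply: clopenableI; apply: clopenable_preimage.
+ by move=> ?; exact: cvg_fst.
+ exact: (polish_borel_clopenable pX).
+ by move=> ?; exact: cvg_snd.
+ exact: (polish_borel_clopenable pY).
Qed.

Section Dichotomy.
Variables (R : realType) (X Y : topologicalType) (x0 : X) (A : set (X * Y)).
Hypotheses (pX : polish R X) (pY : polish R Y).
Hypotheses (sX : open_separated X) (sY : open_separated Y).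
Variables (DA DB : set (nat -> nat)) (phi chi : (nat -> nat) -> X * Y).
Hypotheses (cDA : baire_closed DA) (cphi : baire_continuous DA phi).
Hypotheses (cDB : baire_closed DB) (cchi : baire_continuous DB chi).
Hypotheses (AE : A = phi @` DA) (BE : ~` A = chi @` DB).

Let cfst : continuous (@fst X Y). Proof. by move=> ?; exact: cvg_fst. Qed.
Let csnd : continuous (@snd X Y). Proof. by move=> ?; exact: cvg_snd. Qed.

(* Codes of a point of [A] (at [None]) and of two points of its complement (at
   [Some false] and [Some true]) that form an edge. *)
Definition is_edge : set (option bool * nat -> nat) :=
  [set c : option bool * nat -> nat |
           [/\ DA (c \o pair None), DB (c \o pair (Some false)),
               DB (c \o pair (Some true)),
               (phi (c \o pair None)).1 = (chi (c \o pair (Some false))).1 &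
               (phi (c \o pair None)).2 = (chi (c \o pair (Some true))).2]].

Lemma is_edge_closed : baire_closed is_edge.
Proof.
pose D := [set c : option bool * nat -> nat | DA (c \o pair None)] `&`
  ([set c : option bool * nat -> nat | DB (c \o pair (Some false))] `&`
   [set c : option bool * nat -> nat | DB (c \o pair (Some true))]).
have cD : baire_closed D.
  by do ?apply: baire_closedI; exact: baire_closed_comp.
have cN : baire_continuous D
    (fun c : option bool * nat -> nat => phi (c \o pair None)).
  by apply: baire_continuous_sub (baire_continuous_comp cphi) => c [].
have cS b : baire_continuous D
    (fun c : option bool * nat -> nat => chi (c \o pair (Some b))).
  apply: baire_continuous_sub (baire_continuous_comp cchi) => c [_ []].
  by case: b.
have -> : is_edge =
    [set c : option bool * nat -> nat |
      D c /\ (phi (c \o pair None)).1 = (chi (c \o pair (Some false))).1] `&`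
    [set c : option bool * nat -> nat |
      D c /\ (phi (c \o pair None)).2 = (chi (c \o pair (Some true))).2].
  apply/seteqP; split => c.
    by move=> [? ? ? ? ?].
  by move=> [[[? [? ?]] ?] [_ ?]]; split.
apply: baire_closedI.
  apply: (baire_closed_eq sX cD); first exact: (baire_continuous_image cfst cN).
  exact: (baire_continuous_image cfst (cS false)).
apply: (baire_closed_eq sY cD); first exact: (baire_continuous_image csnd cN).
exact: (baire_continuous_image csnd (cS true)).
Qed.

(** * Finite graphs and their configurations *)

Definition node : Type := (seq bool + nat * seq bool)%type.

Definition node_code (c : node * nat -> nat) (x : node) : nat -> nat :=
  c \o pair x.

(** A node [inl t] is a vertex; [inr (k, t)] is the edge between the vertices [sseq k ++ false :: t]
    and [sseq k ++ true :: t]. The code of a point of [A] sits at the edge, those of points of the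
    complement at its two ends. *)
Definition edge_ends (k : nat) (t : seq bool) (j : option bool * nat) :
    node * nat :=
  (if j.1 is Some b then inl (sseq k ++ b :: t) else inr (k, t), j.2).

(** Complete codes are assigned to all nodes, but only the vertices of length [n] and the edges
    between them are constrained. *)
Definition configuration (n : nat) : set (node * nat -> nat) :=
  [set c : node * nat -> nat |
           (forall t, size t = n -> DB (node_code c (inl t))) /\
           (forall k t, k + (size t).+1 = n -> is_edge (c \o edge_ends k t))].

Lemma configuration_closed (n : nat) : baire_closed (configuration n).
Proof.
apply: baire_closedI.
  apply: baire_closed_forall => t; apply: baire_closed_imply => _.
  exact: baire_closed_comp.
apply: baire_closed_forall => k; apply: baire_closed_forall => t.
apply: baire_closed_imply => _.
exact: (baire_closed_comp (p := edge_ends k t) is_edge_closed).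
Qed.

Definition bseqs (n : nat) : seq (seq bool) :=
  [seq tval t | t <- enum {: n.-tuple bool}].

Lemma mem_bseqs (t : seq bool) : t \in bseqs (size t).
Proof. by apply/mapP; exists (in_tuple t); rewrite ?mem_enum. Qed.

(** The part of a configuration that is fixed at stage [n]: the first [n] entries of the codes at
    the nodes of level [n]. It is finite, so there are only countably many approximations. *)
Definition window (n : nat) : seq (node * nat) :=
  [seq (x, i) | x <- [seq inl t : node | t <- bseqs n] ++
                     [seq inr (k, t) : node | k <- iota 0 n,
                                              t <- bseqs (n - k.+1)],
                i <- iota 0 n].

Lemma mem_window_vertex (n i : nat) (t : seq bool) : size t = n -> i < n ->
  (inl t, i) \in window n.
Proof.
move=> <- ilt; apply: allpairs_f; last by rewrite mem_iota.
by rewrite mem_cat map_f// mem_bseqs.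
Qed.

Lemma mem_window_edge (n i k : nat) (t : seq bool) : k + (size t).+1 = n ->
  i < n -> (inr (k, t), i) \in window n.
Proof.
move=> nE ilt; apply: allpairs_f; last by rewrite mem_iota.
rewrite mem_cat; apply/orP; right; apply: allpairs_f_dep.
  by rewrite mem_iota /= add0n -nE -addSnnS leq_addr.
suff -> : n - k.+1 = size t by exact: mem_bseqs.
by rewrite -nE -addSnnS addKn.
Qed.

Lemma window0 : window 0 = [::].
Proof.
case E : (window 0) => [//|j s]; have : j \in window 0 by rewrite E mem_head.
by move=> /allpairsP[[x i]] [].
Qed.

Definition restriction (n : nat) (c : node * nat -> nat) : seq nat :=
  [seq c j | j <- window n].

Lemma restriction_eq (n : nat) (c c' : node * nat -> nat) :
  restriction n c = restriction n c' <-> {in window n, c =1 c'}.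
Proof. by split => [/eq_in_map|/eq_in_map]. Qed.

(** The graph of level [n.+1] consists of two copies of the graph of level [n], told apart by the
    last digit, and of one new edge joining the two copies of [sseq n]. *)
Definition half_node (b : bool) (x : node) : node :=
  match x with inl t => inl (rcons t b) | inr (k, t) => inr (k, rcons t b) end.

Definition half (b : bool) (c : node * nat -> nat) : node * nat -> nat :=
  fun j => c (half_node b j.1, j.2).

Definition avoids (n : nat) (W : set (X * Y)) : set (node * nat -> nat) :=
  [set c | forall t, size t = n -> ~ W (chi (node_code c (inl t)))].

(** The last digit selects the copy. The code [a] goes to edges with empty tail; at level [n.+1] the
    new edge is the only one. *)
Definition glue (c0 c1 : node * nat -> nat) (a : nat -> nat) :
    node * nat -> nat :=
  fun j =>
  match j.1 with
  | inl t => (if last false t then c1 else c0) (inl (take (size t).-1 t), j.2)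
  | inr (k, t) => if t is [::] then a j.2 else
      (if last false t then c1 else c0) (inr (k, take (size t).-1 t), j.2)
  end.

Lemma half_glue (c0 c1 : node * nat -> nat) (a : nat -> nat) (b : bool) :
  half b (glue c0 c1 a) = if b then c1 else c0.
Proof.
have tk t : take (size (rcons t b)).-1 (rcons t b) = t.
  by rewrite size_rcons /= -cats1 take_size_cat.
apply/funext => -[[t|[k t]] i]; rewrite /half /glue /= last_rcons.
  by rewrite tk.
rewrite tk; case E : (rcons t b) => [|? ?]; last by [].
by move: (congr1 size E); rewrite size_rcons.
Qed.

Lemma glue_vertex (c0 c1 : node * nat -> nat) (a : nat -> nat) (b : bool)
    (t : seq bool) :
  node_code (glue c0 c1 a) (inl (rcons t b)) =
  node_code (if b then c1 else c0) (inl t).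
Proof. by rewrite -(half_glue c0 c1 a b). Qed.

Lemma glue_configuration (n : nat) (c0 c1 : node * nat -> nat) (a : nat ->
  nat) :
  configuration n c0 -> configuration n c1 -> DA a ->
  (phi a).1 = (chi (node_code c0 (inl (sseq n)))).1 ->
  (phi a).2 = (chi (node_code c1 (inl (sseq n)))).2 ->
  configuration n.+1 (glue c0 c1 a).
Proof.
move=> conf0 conf1 Da a1 a2; split.
  elim/last_ind => // t b _; rewrite size_rcons => -[tn].
  by rewrite glue_vertex; case: b; [case: conf1|case: conf0] => + _; apply.
move=> k; elim/last_ind => [|t b _].
  rewrite addn1 => -[->].
  have vE b : (glue c0 c1 a \o edge_ends n [::]) \o pair (Some b) =
      node_code (if b then c1 else c0) (inl (sseq n)).
    by rewrite -(glue_vertex _ _ a) -cats1.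
  split; rewrite ?vE//.
  - by case: conf0 => + _; apply; exact: size_sseq.
  - by case: conf1 => + _; apply; exact: size_sseq.
rewrite size_rcons addnS => -[tn].
have -> : glue c0 c1 a \o edge_ends k (rcons t b) =
    (if b then c1 else c0) \o edge_ends k t.
  rewrite -(half_glue c0 c1 a b); apply/funext => -[[b'|] i] //.
  by rewrite /half /edge_ends /= rcons_cat.
by case: b; [case: conf1|case: conf0] => _; apply.
Qed.

(** Both halves of an extension have to restrict to the same [p]: entries fixed at one stage are
    thus kept at all nodes above, which makes the construction converge. *)
Definition terminal (n : nat) (p : seq nat) (W : set (X * Y)) : Prop :=
  forall c, configuration n.+1 c -> avoids n.+1 W c ->
  ~ (restriction n (half false c) = p /\ restriction n (half true c) = p).

Definition bad (n : nat) (p : seq nat) : Prop :=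
  exists W, [/\ rectangle_union W, W `<=` ~` A & terminal n p W].

(** The points available at [sseq n], the vertex whose two copies the new edge joins. *)
Definition traces (n : nat) (p : seq nat) (W : set (X * Y)) : set (X * Y) :=
  [set chi (node_code c (inl (sseq n))) | c in
    configuration n `&` avoids n W `&` [set c | restriction n c = p]].

(** The extra indices [seq bool * nat] store at each vertex the value of the function that makes [W]
    clopen, so that avoiding [W] becomes a closed condition. *)
Lemma traces_analytic (n : nat) (p : seq nat) (W : set (X * Y)) :
  rectangle_union W -> analytic (traces n p W).
Proof.
move=> /(rectangle_union_clopenable pX pY)[z [i0 [g [cz zW]]]].
pose J := (node * nat + seq bool * nat)%type.
pose V t := [set c : J -> nat | DB (c \o (inl \o pair (inl t)))].
have cV t : baire_closed (V t) by exact: baire_closed_comp.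
have fV t : baire_continuous (V t)
    (fun c : J -> nat => chi (c \o (inl \o pair (inl t)))).
  exact: baire_continuous_comp.
pose E : set (J -> nat) :=
  [set c : J -> nat | configuration n (c \o inl)] `&`
  [set c : J -> nat | restriction n (c \o inl) = p] `&`
  [set c : J -> nat | forall t, size t = n ->
     (V t c /\ z (chi (c \o (inl \o pair (inl t)))) = c \o (inr \o pair t)) /\
     ~~ g (c (inr (t, i0)))].
have -> : traces n p W =
    (fun c : J -> nat => chi (c \o (inl \o pair (inl (sseq n))))) @` E.
  apply/seteqP; split => q [c].
    move=> [[conf av] cp] <-.
    exists (fun j => match j with inl x => c x
                     | inr (t, i) => z (chi (node_code c (inl t))) i end) => //.
    split; first by split.
    move=> t tn; split; first by split => //; case: conf => + _; apply.
    by apply/negP => /zW; exact: av.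
  move=> [[conf cp] zc] <-; exists (c \o inl) => //; split => //; split => //.
  move=> t tn /zW; have [[_ zt] ng] := zc t tn.
  rewrite (_ : z _ = c \o (inr \o pair t))//.
  by move=> h; rewrite h in ng.
apply: analyticW.
  apply: baire_closedI; first apply: baire_closedI.
  - exact: (baire_closed_comp (p := inl) (@configuration_closed n)).
  - have := @baire_closed_coords _ [seq inl j : J | j <- window n] [set q | q =
    p].
    by rewrite /restriction; under eq_set do rewrite -map_comp.
  - apply: baire_closed_forall => t; apply: baire_closed_imply => _.
    apply: baire_closedI; first exact: baire_closed_graph.
    exact: (@baire_closed_coords _ [:: inr (t,
      i0) : J] [set q | ~~ g (head 0 q)]).
apply: baire_continuous_sub (fV (sseq n)) => c [_ /(_ _ (size_sseq n))].
by move=> [[]].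
Qed.

(** A point of [A] in the product of the two projections would code a new edge, and gluing along it
    would give a forbidden extension of [p]. *)
Lemma terminal_traces (n : nat) (p : seq nat) (W : set (X * Y)) :
  terminal n p W ->
  (fst @` traces n p W) `*` (snd @` traces n p W) `<=` ~` A.
Proof.
move=> tW [x y] [/= [_ [c0 [[conf0 av0] p0] <-] <-] [_ [c1 [[conf1 av1] p1']
  <-] <-]].
rewrite AE => -[a Da phia].
have := tW (glue c0 c1 a); apply.
- by apply: glue_configuration; rewrite // phia.
- elim/last_ind => // t b _; rewrite size_rcons => -[tn].
  by rewrite glue_vertex; case: b; [exact: av1|exact: av0].
- by rewrite !half_glue.
Qed.

(** [W1] collects the witnesses of all bad approximations; terminality survives this enlargement.
    [W2] then collects rectangles around the traces taken relative to [W1]. A configuration with a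
    bad restriction that avoids [W1] has its point at [sseq n] in [W2]. *)
Lemma bad_cover : exists W, [/\ rectangle_union W, W `<=` ~` A &
  forall n p, bad n p -> forall c, configuration n c -> restriction n c = p ->
  ~ avoids n W c].
Proof.
have /choice[W WP] : forall np : nat * seq nat, exists W,
    [/\ rectangle_union W, W `<=` ~` A & bad np.1 np.2 -> terminal np.1 np.2 W].
  move=> [n p]; have [[W [rW WA tW]]|nb] := pselect (bad n p);
    first by exists W.
  by exists set0; split => //; exact: rectangle_union0.
pose W1 := \bigcup_k (if unpickle k is Some np then W np else set0).
have rW1 : rectangle_union W1.
  apply: rectangle_union_bigcup => k; case: unpickle => [np|].
    by have [] := WP np.
  exact: rectangle_union0.
have W1A : W1 `<=` ~` A.
  move=> q [k _]; case: unpickle => [np|//].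
  by have [_ + _] := WP np; apply.
have W1W np : W np `<=` W1.
  by move=> q Wq; exists (pickle np) => //; rewrite pickleK.
have tW1 np : bad np.1 np.2 -> terminal np.1 np.2 W1.
  move=> /(let: And3 _ _ h := WP np in h) tW c conf av.
  by apply: tW => // t tn /W1W; exact: av.
have aA : analytic A by exists DA, phi.
have /choice[V VP] : forall np : nat * seq nat, exists V,
    [/\ rectangle_union V, V `<=` ~` A &
        bad np.1 np.2 -> traces np.1 np.2 W1 `<=` V].
  move=> np; have [b|nb] := pselect (bad np.1 np.2); last first.
    by exists set0; split => //; exact: rectangle_union0.
  have aT := @traces_analytic np.1 np.2 W1 rW1.
  have [P [Q [bP bQ PP QQ PQ]]] := analytic_rectangle_separation x0 pX sX sY aA
    (analytic_image cfst aT) (analytic_image csnd aT) (terminal_traces (tW1 np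
      b)).
  exists (P `*` Q); split => //; first exact: rectangle_union1.
  move=> _ q Tq; split; first by apply: PP; exists q.
  by apply: QQ; exists q.
pose W2 := \bigcup_k (if unpickle k is Some np then V np else set0).
exists (\bigcup_k (if k is 0 then W1 else W2)); split.
- apply: rectangle_union_bigcup => -[//|k].
  apply: rectangle_union_bigcup => {}k; case: unpickle => [np|].
    by have [] := VP np.
  exact: rectangle_union0.
- move=> q [[|k] _]; first exact: W1A.
  move=> [m _]; case: unpickle => [np|//].
  by have [_ + _] := VP np; apply.
- move=> n p b c conf cp av; apply: (av (sseq n) (size_sseq n)).
  exists 1 => //; exists (pickle (n, p)) => //; rewrite pickleK.
  have [_ _ /(_ b)] := VP (n, p); apply.
  exists c => //; split => //; split => // t tn Wt; apply: (av t tn).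
  by exists 0.
Qed.

(** At level 0 there is one vertex, no edge and an empty window: any code of a point of the
    complement is a configuration, so no such point escapes [W]. *)
Lemma bad0_cover : bad 0 [::] ->
  exists2 W, rectangle_union W & W = ~` A.
Proof.
move=> b; have [W [rW WA Wbad]] := bad_cover; exists W => //.
apply/seteqP; split => // q; rewrite BE => -[a Da <-].
apply: contrapT => nW.
pose c (j : node * nat) := a j.2.
apply: (Wbad 0 [::] b c); last by move=> t _.
  by split => // k t; rewrite addnS.
by rewrite /restriction window0.
Qed.

(** An approximation that is not bad has an extension avoiding the [W] of [bad_cover], and by the
    choice of [W] the restriction of this extension is again not bad. *)
Lemma bad_chain : ~ bad 0 [::] -> exists c : nat -> node * nat -> nat,
  forall n, configuration n.+1 (c n.+1) /\
    forall b, {in window n, half b (c n.+1) =1 c n}.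
Proof.
move=> nb; have [W [rW WA Wbad]] := bad_cover.
have /choice[next nextP] : forall nc : nat * (node * nat -> nat), exists c',
    ~ bad nc.1 (restriction nc.1 nc.2) ->
    [/\ configuration nc.1.+1 c', ~ bad nc.1.+1 (restriction nc.1.+1 c') &
        forall b, {in window nc.1, half b c' =1 nc.2}].
  move=> [n c] /=; have [?|nbc] := pselect (bad n (restriction n c)).
    by exists c.
  have /existsNP[c' ] : ~ terminal n (restriction n c) W.
    by move=> tW; apply: nbc; exists W.
  move=> /not_implyP[conf /not_implyP[av /contrapT[h0 h1]]].
  exists c' => _; split => //.
    by move=> b; exact: (Wbad _ _ b c').
  by move=> [] j jw; [move/restriction_eq : h1;
    apply|move/restriction_eq : h0; apply].
(* The start is arbitrary, as the window of level 0 is empty; only the later terms are claimed to be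
   configurations. *)
pose c := fix c n := if n is n'.+1 then next (n', c n') else fun=> 0.
have nbc n : ~ bad n (restriction n (c n)).
  elim: n => [|n IH]; first by rewrite /restriction window0.
  by have [] := nextP (n, c n) IH.
exists c => n; have [? _ ?] := nextP (n, c n) (nbc n).
by split.
Qed.

Lemma chain_reduction : ~ bad 0 [::] ->
  exists (u : cantor_space -> X) (v : cantor_space -> Y),
    [/\ continuous u, continuous v, forall al, ~ A (u al, v al) &
        forall a b, A0 (a, b) -> A (u a, v b)].
Proof.
move=> /bad_chain[c cP].
(* Entry [i] of a vertex code lies in the window from stage [i.+1] on, so its value there is
   final. *)
pose f (al : nat -> bool) i := c i.+1 (inl (mkseq al i.+1), i).
have fE al i n : i < n -> c n (inl (mkseq al n), i) = f al i.
  move=> /subnKC <-; elim: (n - i.+1) => [|m IH]; first by rewrite addn0.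
  rewrite addnS -IH -((cP (i.+1 + m)).2 (al (i.+1 + m))).
    by rewrite mkseqS.
  by apply: mem_window_vertex; rewrite ?size_mkseq// leq_addr.
(* An edge [(k, t)] with [t] of length [i] has level [k + i.+1], whose window contains entry [i]. *)
pose g k (be : nat -> bool) i := c (k + i.+1) (inr (k, mkseq be i), i).
have gE k be i m : i <= m -> c (k + m.+1) (inr (k, mkseq be m), i) = g k be i.
  move=> /subnKC <-; elim: (m - i) => [|{}m IH]; first by rewrite addn0.
  rewrite !addnS -IH -addnS -((cP (k + (i + m).+1)).2 (be (i + m))).
    by rewrite mkseqS.
  apply: mem_window_edge; rewrite ?size_mkseq//.
  by apply: ltn_addl; rewrite ltnS leq_addr.
have DBf al : DB (f al).
  apply: cDB => F; set N := (\max_(i <- F) i).+1.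
  exists (node_code (c N) (inl (mkseq al N))).
    by have [[+ _] _] := cP (\max_(i <- F) i); apply; exact: size_mkseq.
  move=> i iF; rewrite /node_code /= fE// ltnS.
  by rewrite (big_rem _ iF) leq_maxl.
have edge (a a' : cantor_space) : A0 (a, a') ->
    A ((chi (f a)).1, (chi (f a')).2).
  move=> [k [be [-> ->]]].
  pose d b := prepend (rcons (sseq k) b) be.
  pose l (j : option bool * nat) := if j.1 is Some b then f (d b) j.2 else g k
    be j.2.
  (* On any finite set of entries the limit codes agree with an edge of some configuration, and
     being an edge is a closed condition. *)
  suff [Dg _ _ e1 e2] : is_edge l.
    rewrite AE; exists (g k be) => //.
    rewrite [LHS]surjective_pairing; congr (_, _); [exact: e1|exact: e2].
  apply: is_edge_closed => F; set m := \max_(j <- F) j.2.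
  exists (c (k + m.+1) \o edge_ends k (mkseq be m)).
    have [[_ +] _] := cP (k + m); rewrite -addnS; apply.
    by rewrite size_mkseq.
  move=> [x i] oF; have im : i <= m.
    by rewrite /m (big_rem _ oF) leq_maxl.
  case: x oF => [b|] oF; rewrite /l /edge_ends /=; last by rewrite gE.
  have -> : sseq k ++ b :: mkseq be m = mkseq (d b) (k + m.+1).
    apply: (@eq_from_nth _ false).
      by rewrite size_cat /= !size_mkseq size_sseq.
    move=> j; rewrite size_cat /= size_mkseq size_sseq => jlt.
    rewrite nth_mkseq// nth_cat size_sseq /d; case: ltngtP => kj.
    - by rewrite prepend_lt// size_sseq.
    - rewrite prepend_gt ?size_sseq// -[j - k]prednK ?subn_gt0//= nth_mkseq
      ?subnS//.
      by rewrite -subnS ltn_subLR// addSnnS.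
    - by rewrite kj subnn /= -[X in prepend _ _ X](size_sseq k) prepend_size.
  by rewrite fE//; apply: ltn_addl; rewrite ltnS.
have cchif (T : topologicalType) (h : X * Y -> T) : continuous h ->
    continuous (fun al : cantor_space => h (chi (f al))).
  move=> ch; apply/cantor_continuousP => al U oU Ual.
  have [F FU] := baire_continuous_image ch cchi (DBf al) oU Ual.
  exists (\max_(i <- F) i).+1 => be albe; apply: FU => // i iF.
  rewrite /f; congr (c _ (inl _, _)); apply/eq_in_map => j.
  rewrite mem_iota add0n => /= ji; rewrite albe// (leq_trans ji)// ltnS.
  by rewrite (big_rem _ iF) leq_maxl.
exists (fun al => (chi (f al)).1), (fun al => (chi (f al)).2); split => //.
- exact: (cchif _ _ cfst).
- exact: (cchif _ _ csnd).
- move=> al; rewrite -surjective_pairing; change ((~` A) (chi (f al))).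
  by rewrite BE; exists (f al).
Qed.

End Dichotomy.

Lemma polish_open_separated (R : realType) (X : topologicalType) :
  polish R X -> open_separated X.
Proof.
by move=> [_ /metric_polish_dist[d pd]]; exact: (polish_dist_hausdorff pd).
Qed.

Lemma potentially_closed_or_reduction (R : realType) (X Y : topologicalType)
    (A : set (X * Y)) :
  polish R X -> polish R Y -> borel A ->
  potentially_closed R A \/
  exists (u : cantor_space -> X) (v : cantor_space -> Y),
    [/\ continuous u, continuous v, forall al, ~ A (u al, v al) &
        forall a b, A0 (a, b) -> A (u a, v b)].
Proof.
move=> pX pY bA.
have [[[x0 y0] _]|nXY] := pselect (exists p : X * Y, True); last first.
  left; exists (Topological.class X), (Topological.class Y); split => //.
  have -> : A = set0 by rewrite -subset0 => p; case: nXY; exists p.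
  exact: closed0.
have cA := polish_prod_borel_clopenable pX pY bA.
have aT : analytic (@setT (X * Y)).
  by apply: analytic_prodT; [exact: (polish_analytic x0 pX)|exact:
    (polish_analytic y0 pY)].
have [DA [phi [cDA cphi AE]]] := analytic_clopenable aT cA.
have [DB [chi [cDB cchi BE]]] := analytic_clopenable aT (clopenableC cA).
have sX := polish_open_separated pX; have sY := polish_open_separated pY.
have [b|nb] := pselect (bad A DA DB phi chi 0 [::]); last first.
  by right; exact: (chain_reduction x0 pX pY sX sY cDA cphi cDB cchi AE BE nb).
left.
have [W [P [Q [bP bQ WE]]] WA] := bad0_cover x0 pX pY sX sY cDA cphi cDB cchi
  AE BE b.
apply: (rectangles_potentially_closed x0 y0 pX pY (P := P) (Q := Q)).
- by move=> n; exact: (polish_borel_clopenable pX).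
- by move=> n; exact: (polish_borel_clopenable pY).
- by rewrite -WA.
Qed.

(** * Baire category *)

Definition bcyl (s : seq bool) : set cantor_space :=
  [set al | forall i, i < size s -> al i = nth false s i].

Lemma bcyl_cat (s r : seq bool) : bcyl (s ++ r) `<=` bcyl s.
Proof.
move=> al sal i si; rewrite sal ?size_cat ?ltn_addr//.
by rewrite nth_cat si.
Qed.

Lemma bcyl_ext (s : seq bool) (al : cantor_space) (m : nat) : bcyl s al ->
  size s <= m -> exists r, mkseq al m = s ++ r.
Proof.
move=> sal sm; exists (drop (size s) (mkseq al m)).
rewrite -{1}(cat_take_drop (size s) (mkseq al m)); congr (_ ++ _).
apply: (@eq_from_nth _ false).
  by rewrite size_takel// size_mkseq.
move=> i; rewrite size_takel ?size_mkseq// => si.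
by rewrite nth_take// nth_mkseq ?sal// (leq_trans si).
Qed.

Definition nowhere_dense (F : set cantor_space) : Prop :=
  forall s, exists r, bcyl (s ++ r) `<=` ~` F.

Definition meager (E : set cantor_space) : Prop :=
  exists F : nat -> set cantor_space,
    (forall n, nowhere_dense (F n)) /\ E `<=` \bigcup_n F n.

Lemma meager_sub (E E' : set cantor_space) : E `<=` E' -> meager E' -> meager E.
Proof. by move=> EE' [F [nF E'F]]; exists F; split => // al /EE'/E'F. Qed.

Lemma nowhere_dense0 : nowhere_dense set0.
Proof. by move=> s; exists [::] => al _ []. Qed.

Lemma meager0 : meager set0.
Proof. by exists (fun=> set0); split => [n|al []]; exact: nowhere_dense0. Qed.

Lemma meager_bigcup (I : countType) (E : I -> set cantor_space) :
  (forall i, meager (E i)) -> meager (\bigcup_i E i).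
Proof.
move=> mE; have [F FP] := choice mE.
exists (fun n => if unpickle n is Some (i, k) then F i k else set0); split.
  move=> n; case: unpickle => [[i k]|]; last exact: nowhere_dense0.
  exact: (FP i).1.
move=> al [i _ /(FP i).2[k _ Fk]].
by exists (pickle (i, k)) => //; rewrite pickleK.
Qed.

Lemma meagerU (E E' : set cantor_space) :
  meager E -> meager E' -> meager (E `|` E').
Proof.
move=> mE mE'.
apply: (@meager_sub _ (\bigcup_b (if b then E else E'))).
  by move=> al [Eal|E'al]; [exists true|exists false].
by apply: meager_bigcup => -[].
Qed.

Lemma bcyl_not_meager (s : seq bool) : ~ meager (bcyl s).
Proof.
move=> [F [nF sF]].
have /choice[r rP] : forall nt : nat * seq bool, exists r,
    bcyl (nt.2 ++ r) `<=` ~` F nt.1 by move=> [n t]; exact: nF.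
(* The extra digit makes the lengths unbounded, so the cylinders determine a single point. *)
pose t := fix t n := if n is n'.+1 then rcons (t n' ++ r (n',
  t n')) false else s.
have tS n : t n.+1 = t n ++ (rcons (r (n, t n)) false) by rewrite /= rcons_cat.
have tsz n : n <= size (t n).
  by elim: n => // n IH; rewrite /= size_rcons size_cat ltnS (leq_trans IH)//
    leq_addr.
have tD n m i : i < size (t n) -> nth false (t (n + m)) i = nth false (t n) i.
  elim: m => [|m IH] ilt; first by rewrite addn0.
  rewrite addnS tS nth_cat IH// ifT//; apply: leq_trans ilt _.
  elim: m {IH} => [|m IH]; first by rewrite addn0.
  by rewrite addnS tS size_cat (leq_trans IH)// leq_addr.
pose al : cantor_space := fun i => nth false (t i.+1) i.
have alt n : bcyl (t n) al.
  by move=> i ilt; rewrite /al -(tD i.+1 n)// addnC tD.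
have [n _] := sF al (alt 0).
apply: (rP (n, t n)) => /=; have := alt n.+1; rewrite /= -cats1.
exact: bcyl_cat.
Qed.

(** Banach's category theorem: the points with no cylinder around them in which [E] is meager form a
    nowhere dense set, and countably many cylinders cover the rest of [E]. *)
Lemma locally_meager (E : set cantor_space) :
  (forall s, exists r, meager (E `&` bcyl (s ++ r))) -> meager E.
Proof.
move=> lE; pose F := [set al | forall s, bcyl s al -> ~ meager (E `&` bcyl s)].
have nF : nowhere_dense F.
  by move=> s; have [r mr] := lE s; exists r => al sal /(_ _ sal).
apply: (@meager_sub _ (F `|` \bigcup_(s : seq bool)
    (if `[< meager (E `&` bcyl s) >] then E `&` bcyl s else set0))).
  move=> al Eal; have [Fal|] := pselect (F al); first by left.
  move=> /existsNP[s /not_implyP[sal /contrapT mE]].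
  by right; exists s => //; rewrite asboolT.
apply: meagerU; first by exists (fun=> F); split => // al Fal; exists 0.
by apply: meager_bigcup => s; case: asboolP => // _; exact: meager0.
Qed.

(* Equivalent to the Baire property, but does not mention the open set that
   approximates [E]. *)
Definition decides (E : set cantor_space) : Prop :=
  forall s, exists r, meager (bcyl (s ++ r) `\` E) \/ meager (E `&` bcyl (s ++
    r)).

Lemma borel_decides (E : set cantor_space) : borel E -> decides E.
Proof.
suff sa : sigma_algebra setT decides.
  have op : @open cantor_space `<=` decides.
    move=> U oU s; have [[al [Ual sal]]|nU] := pselect (exists al,
      U al /\ bcyl s al).
      have /cantor_nbhsP[n nU] : nbhs al U by exact: open_nbhs_nbhs.
      have [r rE] := bcyl_ext sal (leq_maxl (size s) n).
      exists r; left; rewrite -rE.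
      apply: meager_sub meager0 => be [rbe]; apply; apply: nU => i im.
      rewrite rbe ?size_mkseq ?nth_mkseq// leq_max im orbT//.
    exists [::]; right; rewrite cats0.
    by apply: meager_sub meager0 => be [Ube sbe]; apply: nU; exists be.
  exact: (smallest_sub sa op).
split.
- by move=> s; exists [::]; right; apply: meager_sub meager0 => al [].
- move=> E' dE s; have [r [mE|mE]] := dE s; exists r; [right|left].
    by apply: meager_sub mE => al [[_ nE] sal].
  by apply: meager_sub mE => al [sal nE]; split => //; apply: contrapT => nE';
    apply: nE.
- move=> F dF s.
  (* Either some [F n] is comeager in a cylinder inside [bcyl s], and so is the union, or every
     [F n] is locally meager in [bcyl s], hence meager there. *)
  have [[n [r mr]]|nr] := pselect (exists n r, meager (bcyl (s ++ r) `\` F n)).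
    exists r; left; apply: meager_sub mr => al [sal nF]; split => // Fn.
    by apply: nF; exists n.
  exists [::]; right; rewrite cats0 setI_bigcupl; apply: meager_bigcup => n.
  apply: locally_meager => s'.
  have [[al [sal sal']]|dis] := pselect (exists al, bcyl s al /\ bcyl s' al);
    last first.
    exists [::]; rewrite cats0; apply: meager_sub meager0 => al [[_ sal] sal'].
    by apply: dis; exists al.
  have [x xE] := bcyl_ext sal (leq_maxl (size s) (size s')).
  have [x' xE'] := bcyl_ext sal' (leq_maxr (size s) (size s')).
  have [r [mr|mr]] := dF n (s ++ x).
    by exfalso; apply: nr; exists n, (x ++ r); rewrite catA.
  exists (x' ++ r); rewrite catA -xE' xE.
  by apply: meager_sub mr => be [[]].
Qed.

Lemma decides_not_meager (E : set cantor_space) : decides E -> ~ meager E ->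
  exists s, meager (bcyl s `\` E).
Proof.
move=> dE nE; apply: contrapT => nP; apply/nE/locally_meager => s.
have [r [mr|mr]] := dE s; last by exists r.
by exfalso; apply: nP; exists (s ++ r).
Qed.

Lemma meager_prepend (w : seq bool) (E : set cantor_space) :
  meager E -> meager [set g | E (prepend w g)].
Proof.
move=> [F [nF EF]]; exists (fun n => [set g | F n (prepend w g)]); split.
  move=> n s; have [r rF] := nF n (w ++ s); exists r => g sg; apply: rF.
  rewrite -catA => i; rewrite size_cat => ilt; rewrite /prepend nth_cat.
  case: ltnP => wi; first exact: set_nth_default.
  by rewrite nth_default// sg// ltn_subLR.
by move=> g /EF[n _ Fn]; exists n.
Qed.

Lemma reduction_not_potentially_closed (R : realType) (X Y : topologicalType)
    (A : set (X * Y)) (u : cantor_space -> X) (v : cantor_space -> Y) :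
  polish R X -> polish R Y -> continuous u -> continuous v ->
  (forall al, ~ A (u al, v al)) -> (forall a b, A0 (a, b) -> A (u a, v b)) ->
  ~ potentially_closed R A.
Proof.
move=> pX pY cu cv nA AA [s [t [so to ps pt clA]]].
have [BX [oBX bBX]] := @polish_base R (Topological.Pack s) (u point) ps.
have [BY [oBY bBY]] := @polish_base R (Topological.Pack t) (v point) pt.
(* Preimages along the diagonal of the basic rectangles that miss [A]; they cover the Cantor space
   because the diagonal is mapped outside [A]. *)
pose E (ij : nat * nat) := if `[< BX ij.1 `*` BY ij.2 `<=` ~` A >] then
  (u @^-1` BX ij.1) `&` (v @^-1` BY ij.2) else set0.
have cover : bcyl [::] `<=` \bigcup_ij E ij.
  move=> al _.
  have oA : @open (Topological.Pack s * Topological.Pack t)%type (~` A).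
    exact: closed_openC.
  have [[V W] /= [Vx Wy] VWA] :
      nbhs (u al : Topological.Pack s, v al : Topological.Pack t) (~` A).
    exact: (@open_nbhs_nbhs (Topological.Pack s * Topological.Pack t)%type
      (u al, v al) (~` A) (conj oA (nA al))).
  have nbE (T : topologicalType) (p : T) (Z : set T) :
      nbhs p Z -> exists2 B, open_nbhs p B & B `<=` Z by rewrite nbhsE.
  have [V' [oV' V'x] VV] := nbE (Topological.Pack s) _ _ Vx.
  have [W' [oW' W'y] WW] := nbE (Topological.Pack t) _ _ Wy.
  have [i ix iV] := bBX _ _ oV' V'x; have [j jy jW] := bBY _ _ oW' W'y.
  exists (i, j) => //; rewrite /E asboolT => //= -[x y] [/= xi yj].
  by apply: (VWA (x, y)); split; [exact/VV/iV|exact/WW/jW].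
have dE ij : decides (E ij).
  rewrite /E; case: asboolP => _; apply: borel_decides; last exact: borel0.
  rewrite -bigcap2E; apply: borel_bigcap => -[|[|n]] /=.
  - apply: (borel_preimage cu).
    exact: (finer_polish_open_borel (u point) ps (polish_open_separated pX) so).
  - apply: (borel_preimage cv).
    exact: (finer_polish_open_borel (v point) pt (polish_open_separated pY) to).
  - by apply: borel_open; exact: openT.
have [ij /(decides_not_meager (dE ij))[w mw]] : exists ij, ~ meager (E ij).
  apply: contrapT => /forallNP mE; apply: (@bcyl_not_meager [::]).
  apply: meager_sub cover _; apply: meager_bigcup => ij.
  by apply: contrapT; exact: mE.
have [m wm mw'] := sseq_dense (nth false w) (size w).
(* [E ij] is comeager in [bcyl w] and [sseq m] extends [w], so for a generic tail [g] both ends of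
   the edge at [sseq m] lie in [E ij]. *)
have [g ng] : exists g, ~ ((bcyl w `\` E ij) (prepend (rcons (sseq m) false) g)
  \/
                          (bcyl w `\` E ij) (prepend (rcons (sseq m) true) g)).
  apply: contrapT => /forallNP h; apply: (@bcyl_not_meager [::]).
  apply: (meager_sub _ (meagerU (meager_prepend (rcons (sseq m) false) mw)
                                (meager_prepend (rcons (sseq m) true) mw))).
  by move=> g _; apply: contrapT; exact: h.
have Eg b : E ij (prepend (rcons (sseq m) b) g).
  apply: contrapT => nE; apply: ng.
  have bw : bcyl w (prepend (rcons (sseq m) b) g).
    by move=> i iw; rewrite prepend_lt ?mw'// size_sseq (leq_trans iw).
  by case: b nE bw => nE bw; [right|left].
have A0g : A0 (prepend (rcons (sseq m) false) g,
  prepend (rcons (sseq m) true) g).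
  by exists m, g.
move: (Eg false) (Eg true); rewrite /E; case: asboolP => // sub [ux _] [_ vy].
exact: (sub (_, _) (conj ux vy) (AA _ _ A0g)).
Qed.

(** * The Cantor plane *)

Lemma polish_distW (R : realType) (T : topologicalType) (d : T -> T -> R) :
  polish_dist d ->
  (exists2 D : set T, countable D &
     forall x (e : R), (0 < e)%R -> exists2 y, D y & (d x y < e)%R) ->
  polish R T.
Proof.
move=> [dd dO dc] sepd.
have [s /= [[[D cD dD] [m [mo mc]]] sO]] := dist_metric_topology dd dc sepd.
have oE (U : set T) : @open (Topological.Pack s) U <-> @open T U.
  by rewrite dO; exact: sO.
split; first by exists D => // U U0 /oE; exact: (dD U U0).
exists m; split => // U.
by rewrite -oE; exact: mo.
Qed.

Definition agree (n : nat) (a b : nat -> bool) : Prop :=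
  forall i, i < n -> a i = b i.

Lemma agree_sub (m n : nat) (a b : nat -> bool) :
  m <= n -> agree n a b -> agree m a b.
Proof. by move=> mn ab i im; apply: ab; exact: leq_trans mn. Qed.

Lemma agree_sym (n : nat) (a b : nat -> bool) : agree n a b -> agree n b a.
Proof. by move=> ab i /ab. Qed.

Lemma agree_trans (n : nat) (b a c : nat -> bool) :
  agree n a b -> agree n b c -> agree n a c.
Proof. by move=> ab bc i ilt; rewrite ab// bc. Qed.

Lemma cantor_polish (R : realType) : polish R cantor_space.
Proof.
pose e (al : cantor_space) : nat -> nat := fun i => nat_of_bool (al i).
have eI al be i : e al i = e be i -> al i = be i.
  by rewrite /e; case: (al i) (be i) => -[].
pose d al be := baire_dist R (e al) (e be).
have [b0 bp bs bt] := baire_dist_is_dist R.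
have dlt al be k : (d al be < k.+1%:R^-1)%R <-> agree k.+1 al be.
  rewrite /d baire_dist_lt; split => [ab i ik|ab i ik]; first exact/eI/ab.
  by rewrite /e ab.
apply: (@polish_distW _ _ d).
  split.
  - split; rewrite /d//.
    by move=> al be /bp eab; apply/funext => i; apply: eI; rewrite eab.
  - move=> U; rewrite openE; split.
      move=> oU al /oU /cantor_nbhsP[n nU]; exists n.+1%:R^-1%R.
        exact: invS_gt0.
      move=> be /dlt ab; apply: nU => i ilt.
      by rewrite ab// ltnS ltnW.
    move=> dU al /dU[r r0 rU]; have [n nr] := invS_lt r0.
    apply/cantor_nbhsP; exists n.+1 => be ab; apply: rU.
    apply: lt_trans nr; apply/dlt => i ilt; exact/esym/ab.
  - move=> u cu.
    have /choice[N NP] : forall k, exists N, forall m n, N <= m -> N <= n ->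
        agree k.+1 (u m) (u n).
      move=> k; have [N uN] := cu _ (invS_gt0 R k).
      by exists N => m n Nm Nn; apply/dlt; exact: uN.
    pose l : cantor_space := fun i => u (N i) i.
    have ul k n : N k <= n -> agree k.+1 (u n) l.
      move=> kn i ik; rewrite (NP k n (maxn (N k) (N i)))// ?leq_maxl//.
      by rewrite (NP i _ (N i))// leq_maxr.
    exists l => r r0; have [k kr] := invS_lt r0; exists (N k) => n kn.
    by apply: lt_trans kr; apply/dlt; exact: ul.
exists (range (fun s : seq bool => (fun i => nth false s i) : cantor_space)).
  exact/(sub_countable (card_image_le _ _))/countableP.
move=> al r r0; have [k kr] := invS_lt r0.
exists (fun i => nth false (mkseq al k.+1) i); first by exists (mkseq al k.+1).
by apply: lt_trans kr; apply/dlt => i ik; rewrite nth_mkseq.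
Qed.

Lemma cantor_prod_nbhs (a b : cantor_space) (W : set (cantor_space *
  cantor_space))
    (N : nat) :
  (forall a' b' : cantor_space, agree N a' a -> agree N b' b -> W (a', b')) ->
  nbhs (a, b) W.
Proof.
move=> NW; exists ([set a' | agree N a' a], [set b' | agree N b' b]).
  by split; apply/cantor_nbhsP; exists N.
by move=> [a' b'] [/= ? ?]; exact: NW.
Qed.

Lemma cantor_continuous_agree (u : cantor_space -> cantor_space) :
  continuous u <-> forall al L, exists N, forall be,
    agree N be al -> agree L (u be) (u al).
Proof.
split.
  move=> cu al L; have : nbhs (u al) [set be : cantor_space | agree L be (u
    al)].
    by apply/cantor_nbhsP; exists L.
  by move=> /(cu al)/cantor_nbhsP[N NP]; exists N.
move=> cu al U /cantor_nbhsP[L LU]; have [N NP] := cu al L.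
by apply/cantor_nbhsP; exists N => be /NP/LU.
Qed.

Lemma distinct_open : open [set p : cantor_space * cantor_space | p.1 <> p.2].
Proof.
rewrite openE => -[a b] /= ab.
have [i ni] : exists i, a i <> b i.
  by apply: contrapT => /forallNP h; apply/ab/funext => i;
    apply: contrapT => /h.
apply: (@cantor_prod_nbhs _ _ _ i.+1) => a' b' aa bb /= ab'.
by apply: ni; rewrite -aa// -bb// ab'.
Qed.

(** For an edge [(a, b)], none of [(a, a)], [(b, a)], [(b, b)] is an edge, so that
    [u a = v a = u b = v b], against [(a, b)] being one. *)
Lemma distinct_no_full_reduction (u v : cantor_space -> cantor_space) :
  A0 <> [set p | u p.1 <> v p.2].
Proof.
move=> AE.
have uv a b : ~ A0 (a, b) -> u a = v b.
  by rewrite AE /= => /contrapT.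
have asym a b : A0 (a, b) -> ~ A0 (b, a).
  move=> /A0P[n [_ an bn ab]] /A0P[m [_ bm am _]].
  have [E|nm] := eqVneq m n; first by rewrite E bn in bm.
  by have := ab m nm; rewrite am bm.
have A0ab : A0 (prepend (rcons (sseq 0) false) point,
  prepend (rcons (sseq 0) true) point).
  by exists 0, point.
move: (A0ab); rewrite {1}AE /=; apply.
rewrite (uv _ _ (@A0_irrefl _)) -(uv _ _ (asym _ _ A0ab)).
by rewrite (uv _ _ (@A0_irrefl _)).
Qed.

(** * A set without injective reductions *)

Definition spad (k : nat) : nat -> bool := nth false (sseq k).

(* [kills P n x j]: position [j] of [x] is a 1 at a node [P (spad j)] and
   position [n] is attached to a node above the opposite branch. *)
Definition kills (P : (nat -> bool) -> nat -> bool) (n : nat) (x : nat -> bool)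
    (j : nat) : Prop :=
  [/\ j < n, agree j (P x) (P (spad j)), P x j,
      agree j (P (spad n)) (P (spad j)) & ~~ P (spad n) j].

(** Position [n] depends on the masks of [x] and of the [spad j] below [n], so the recursion is on a
    bound for positions; only values below the bound are meaningful. *)
Fixpoint mask_upto (n : nat) (x : nat -> bool) (i : nat) : bool :=
  if n is n'.+1 then
    if i == n' then x i && ~~ `[< exists j, kills (mask_upto n') n' x j >]
    else mask_upto n' x i
  else false.

Definition mask (x : nat -> bool) : nat -> bool := fun i => mask_upto i.+1 x i.

Definition killed (n : nat) (x : nat -> bool) : Prop :=
  exists j, kills mask n x j.

Lemma mask_uptoE (n i : nat) (x : nat -> bool) :
  i < n -> mask_upto n x i = mask x i.
Proof.
elim: n => // n IH; rewrite ltnS leq_eqVlt /= => /orP[/eqP->|ilt].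
  by rewrite eqxx /mask /= eqxx.
by rewrite ltn_eqF// IH.
Qed.

Lemma maskE (n : nat) (x : nat ->
  bool) : mask x n = x n && ~~ `[< killed n x >].
Proof.
rewrite /mask /= eqxx; congr (_ && ~~ _); apply: asbool_equiv_eq.
have E y : agree n (mask_upto n y) (mask y) by move=> i; exact: mask_uptoE.
have Ej y j : j < n -> agree j (mask_upto n y) (mask y).
  by move=> jn; exact: agree_sub (ltnW jn) (E y).
split => -[j [jn h1 h2 h3 h4]]; exists j; split => //.
- apply: agree_trans (Ej _ _ jn); apply: agree_trans h1.
  exact/agree_sym/Ej.
- by rewrite -E.
- apply: agree_trans (Ej _ _ jn); apply: agree_trans h3.
  exact/agree_sym/Ej.
- by rewrite -E.
- apply: agree_trans (agree_sym (Ej _ _ jn)); apply: agree_trans h1.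
  exact: Ej.
- by rewrite E.
- apply: agree_trans (agree_sym (Ej _ _ jn)); apply: agree_trans h3.
  exact: Ej.
- by rewrite E.
Qed.

Lemma killed_agree (n : nat) (x y : nat -> bool) :
  agree n (mask x) (mask y) -> killed n x -> killed n y.
Proof.
move=> xy [j [jn h1 h2 h3 h4]]; exists j; split => //.
  by apply: agree_trans h1; apply: agree_sub (ltnW jn) (agree_sym xy).
by rewrite -xy.
Qed.

Lemma mask_agree (n : nat) (x y : nat -> bool) :
  agree n x y -> agree n (mask x) (mask y).
Proof.
elim: n => [//|n IH] xy i; rewrite ltnS leq_eqVlt => /orP[/eqP->|ilt].
  have mxy : agree n (mask x) (mask y) by apply: IH; exact: agree_sub xy.
  rewrite !maskE xy//; congr (_ && ~~ _); apply: asbool_equiv_eq.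
  by split; apply: killed_agree => //; exact: agree_sym.
by apply: IH ilt; exact: agree_sub xy.
Qed.

(** Passing through the node [k] is tested on masks, since different sequences may have the same
    mask. *)
Definition active (k : nat) (x : nat -> bool) : Prop :=
  agree k (mask x) (mask (spad k)).

Definition flip (k : nat) (x : nat -> bool) : nat -> bool :=
  fun i => if i == k then ~~ x i else x i.

Lemma flip_agree (k : nat) (x : nat -> bool) : agree k (flip k x) x.
Proof. by move=> i ik; rewrite /flip ltn_eqF. Qed.

Lemma flip_agree2 (k n : nat) (x y : nat -> bool) :
  agree n x y -> agree n (flip k x) (flip k y).
Proof. by move=> xy i ilt; rewrite /flip xy. Qed.

Lemma flip_inj (k : nat) (x y : nat -> bool) : flip k x = flip k y -> x = y.
Proof.
move=> xy; apply/funext => i; have := congr1 (@^~ i) xy; rewrite /flip.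
by case: eqP => // _; exact: negb_inj.
Qed.

Lemma active_agree (k : nat) (x y : nat -> bool) :
  agree k x y -> active k x -> active k y.
Proof. by move=> /mask_agree/agree_sym xy; exact: agree_trans. Qed.

Lemma active_flip (k : nat) (x : nat -> bool) : active k x ->
  active k (flip k x).
Proof. by apply: active_agree; exact/agree_sym/flip_agree. Qed.

(** A killer [j < k] needs a 1 in the mask of [x] and a 0 in that of [spad k], but the two masks
    agree below [k]. *)
Lemma active_not_killed (k : nat) (x : nat -> bool) : active k x ->
  ~ killed k x.
Proof.
by move=> ak [j [jk _ xj _ /negP]]; apply; rewrite -ak.
Qed.

Lemma active_mask (k : nat) (x : nat -> bool) : active k x -> mask x k = x k.
Proof. by move=> /active_not_killed nk; rewrite maskE asboolF// andbT. Qed.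

Lemma active_flip_kills (k n : nat) (x : nat -> bool) :
  active k x -> x k = false -> k < n ->
  agree k (mask (spad n)) (mask (spad k)) -> mask (spad n) k = false ->
  killed n (flip k x).
Proof.
move=> ak xk kn nk nk0; exists k; split => //; last by rewrite nk0.
  exact: active_flip.
by rewrite active_mask ?/flip ?eqxx ?xk//; exact: active_flip.
Qed.

(** A killer [j] of [n] below [k] is unaffected by the flip. If [j] is above [k], the node [n] lies
    above the branch 0 at [k], so after the flip [k] itself kills [n]. It cannot be [k], where [x]
    is 0. *)
Lemma not_killed_flip (k n : nat) (x : nat -> bool) :
  active k x -> x k = false -> k < n -> ~ killed n (flip k x) -> ~ killed n x.
Proof.
move=> ak xk kn nkf [j [jn h1 h2 h3 h4]]; apply: nkf.
have [jk|kj|jk] := ltngtP j k.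
- have E := mask_agree (@flip_agree k x); exists j; split => //.
    by apply: agree_trans h1; exact: agree_sub (ltnW jk) E.
  by rewrite E.
- apply: active_flip_kills => //.
    apply: agree_trans ak; apply: agree_trans (agree_sub (ltnW kj) h3) _.
    exact: (agree_sub (ltnW kj) (agree_sym h1)).
  by rewrite h3// -h1// active_mask.
- by move: h2; rewrite jk active_mask// xk.
Qed.

Lemma mask_flip_eq (k : nat) (x y : nat -> bool) :
  active k x -> x k = false -> active k y -> y k = false ->
  (forall n, k < n -> ~ killed n (flip k x) -> ~ killed n (flip k y) ->
    x n = y n) ->
  mask (flip k x) = mask (flip k y).
Proof.
move=> ax xk ay yk xy.
suff E n : agree n (mask (flip k x)) (mask (flip k y)).
  by apply/funext => i; exact: (E i.+1).
elim: n => [//|n IH] i; rewrite ltnS leq_eqVlt => /orP[/eqP->|/IH//].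
have kE : killed n (flip k x) <-> killed n (flip k y).
  by split; apply: killed_agree => //; exact: agree_sym.
have [nk|kn|->] := ltngtP n k.
- rewrite (mask_agree (@flip_agree k x))// (mask_agree (@flip_agree k y))//.
  by rewrite ax// ay.
- rewrite !maskE (asbool_equiv_eq kE);
  have [kl|nkl] := pselect (killed n (flip k y)).
    by rewrite asboolT// !andbF.
  rewrite asboolF// !andbT /flip gtn_eqF//; apply: xy => //.
  by move=> /kE.
- by rewrite !active_mask /flip ?eqxx ?xk ?yk//; exact: active_flip.
Qed.

(* Flipping at [k] erases every modification made at a later node above the
   branch that is left. *)
Lemma mask_flip_erase (k k' : nat) (x y : nat -> bool) : k < k' ->
  active k x -> x k = false -> active k' x ->
  active k y -> y k = false -> mask y = mask (flip k' x) ->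
  mask (flip k x) = mask (flip k y).
Proof.
move=> kk' ax xk ax' ay yk yx.
have axf : active k (flip k' x).
  apply: active_agree ax; apply: agree_sym.
  exact: agree_sub (ltnW kk') (@flip_agree k' x).
have xkf : flip k' x k = false by rewrite /flip ltn_eqF.
(* The first two sequences differ only at [k'], which the flip at [k] kills since the node [k'] lies
   above the branch 0 at [k]. *)
transitivity (mask (flip k (flip k' x))).
  apply: mask_flip_eq => // n kn nk _; rewrite {1}/flip.
  case: eqP => // E; subst n; exfalso; apply: nk.
  apply: active_flip_kills => //.
    apply: agree_trans ax; apply: agree_sym.
    exact: agree_sub (ltnW kk') ax'.
  by rewrite -(ax' k kk') active_mask.
(* A position that survives the flip at [k] was not killed before it, so equal masks give equal
   digits there. *)
apply: mask_flip_eq => // n kn nk nk'.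
have := congr1 (@^~ n) yx; rewrite /= !maskE !asboolF ?andbT//.
- exact: not_killed_flip nk.
- exact: not_killed_flip nk'.
Qed.

Lemma mask_continuous : continuous (mask : cantor_space -> cantor_space).
Proof.
by apply/cantor_continuous_agree => al L; exists L => be; exact: mask_agree.
Qed.

(** * The Borel set of erased edges *)

Definition erased_edge (k : nat) (x y : nat -> bool) : Prop :=
  [/\ active k x, x k = false & y = mask (flip k x)].

Definition erased_set : set (cantor_space * cantor_space) :=
  [set p | exists k, erased_edge k p.1 p.2].

Lemma erased_edge_closed (k : nat) (x y : nat -> bool) : ~ erased_edge k x y ->
  exists L, forall x' y', agree L x' x -> agree L y' y -> ~ erased_edge k x' y'.
Proof.
move=> ne; have [[ax xk]|nax] := pselect (active k x /\ x k = false);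
  last first.
  exists k.+1 => x' y' xx _ [ax' xk' _]; apply: nax; split; last by rewrite -xx.
  exact: active_agree (agree_sub (leqnSn k) xx) ax'.
have [i ni] : exists i, y i <> mask (flip k x) i.
  apply: contrapT => /forallNP h; apply: ne; split => //.
  by apply/funext => i; apply: contrapT => /h.
exists i.+1 => x' y' xx yy [_ _ E]; apply: ni.
rewrite -yy// E; apply: (mask_agree (n := i.+1)) => //.
exact: flip_agree2.
Qed.

Lemma erased_edges_closed (n : nat) (x y : nat -> bool) : ~ erased_set (x, y) ->
  exists L, forall x' y', agree L x' x -> agree L y' y ->
  forall k, k <= n -> ~ erased_edge k x' y'.
Proof.
move=> nxy.
have /choice[L LP] : forall k, exists L, forall x' y',
    agree L x' x -> agree L y' y -> ~ erased_edge k x' y'.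
  by move=> k; apply: erased_edge_closed => e; apply: nxy; exists k.
exists (\max_(k <- iota 0 n.+1) L k) => x' y' xx yy k kn.
have Lk : L k <= \max_(k <- iota 0 n.+1) L k.
  by rewrite (big_rem k) ?leq_maxl// mem_iota.
by apply: LP; [exact: agree_sub xx|exact: agree_sub yy].
Qed.

Lemma erased_set_borel : borel erased_set.
Proof.
rewrite (_ : erased_set = \bigcup_k [set p : cantor_space * cantor_space |
    erased_edge k p.1 p.2]); last first.
  by apply/seteqP; split => p [k]; [exists k|exists k].
apply: borel_bigcup => k; rewrite -[X in borel X]setCK.
apply: borelC; apply: borel_open; rewrite openE => -[x y] /= ne.
have [L LP] := erased_edge_closed ne.
by apply: (@cantor_prod_nbhs _ _ _ L) => x' y'; exact: LP.
Qed.

Lemma erased_set_diagonal (al : cantor_space) : ~ erased_set (al, mask al).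
Proof.
move=> [k [/= ak alk /(congr1 (@^~ k))]].
by rewrite /= !active_mask /flip ?eqxx ?alk//; exact: active_flip.
Qed.

Lemma A0_flip (a b : cantor_space) : A0 (a, b) -> exists n,
  [/\ agree n a (spad n), a n = false & b = flip n a].
Proof.
move=> /A0P[n [an a0 b1 ab]]; exists n; split => //.
apply/funext => i; rewrite /flip; case: eqP => [->|/eqP /ab//].
by rewrite a0 b1.
Qed.

Lemma erased_set_edge (a b : cantor_space) : A0 (a, b) -> erased_set (a,
  mask b).
Proof.
move=> /A0_flip[n [an a0 ->]]; exists n; split => //.
exact: mask_agree.
Qed.

Section NoInjectiveReduction.
Variables u v : cantor_space -> cantor_space.
Hypotheses (cu : continuous u) (cv : continuous v).
Hypothesis (nA : forall al, ~ erased_set (u al, v al)).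
Hypothesis (AA : forall a b, A0 (a, b) -> erased_set (u a, v b)).

(** Edges of [A0] accumulate at [(al, al)], whose image is outside the closed set of erased edges of
    index at most [n]; edges close enough therefore get a larger index. *)
Lemma late_edge (al : cantor_space) (n L N : nat) : exists (a b : cantor_space)
  k,
  [/\ A0 (a, b), agree N a al, agree N b al, agree L (u a) (u al) &
      [/\ agree L (v b) (v al), erased_edge k (u a) (v b) & n < k]].
Proof.
have [L' L'P] := erased_edges_closed n (@nA al).
have [M MP] := (cantor_continuous_agree u).1 cu al (maxn L L').
have [M' M'P] := (cantor_continuous_agree v).1 cv al (maxn L L').
have [m mN mP] := sseq_dense al (maxn N (maxn M M')).
pose a b : cantor_space := prepend (rcons (sseq m) b) point.
have aP b : agree (maxn N (maxn M M')) (a b) al.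
  by move=> i ilt; rewrite /a prepend_lt ?mP// size_sseq (leq_trans ilt).
have A0a : A0 (a false, a true) by exists m, point.
have [k ek] := AA A0a.
have uL : agree (maxn L L') (u (a false)) (u al).
  by apply: MP; apply: agree_sub (aP false); rewrite !leq_max leqnn !orbT.
have vL : agree (maxn L L') (v (a true)) (v al).
  by apply: M'P; apply: agree_sub (aP true); rewrite !leq_max leqnn !orbT.
exists (a false), (a true), k; split => //.
- exact: agree_sub (leq_maxl _ _) (aP false).
- exact: agree_sub (leq_maxl _ _) (aP true).
- exact: agree_sub (leq_maxl _ _) uL.
split => //; first exact: agree_sub (leq_maxl _ _) vL.
rewrite ltnNge; apply/negP => kn; apply: L'P ek => //.
- exact: agree_sub (leq_maxr _ _) uL.
- exact: agree_sub (leq_maxr _ _) vL.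
Qed.

(** Along late edges tending to [al], the flipped position goes to infinity and disappears in the
    limit. *)
Lemma reduction_mask (al : cantor_space) : v al = mask (u al).
Proof.
apply/funext => i; have [a [b [k [_ _ _ ua [vb [_ _ E] ik]]]]] := late_edge al
  i i.+1 0.
rewrite -vb// E (mask_agree (@flip_agree k (u a)))//.
exact: (mask_agree ua).
Qed.

(** The edges [(al, flip 0 al)] come from the node [sseq 0]. The sets [C k] of points whose edge
    gets index [k] are closed and cover the cylinder of [[:: false]], so by Baire category one of
    them contains a cylinder. *)
Lemma uniform_first_edge : exists (k : nat) (s : seq bool),
  forall al : cantor_space,
  bcyl s al -> al 0 = false /\ erased_edge k (u al) (v (flip 0 al)).
Proof.
pose C k := [set al : cantor_space |
  al 0 = false /\ erased_edge k (u al) (v (flip 0 al))].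
apply: contrapT => nC; apply: (@bcyl_not_meager [:: false]).
exists C; split; last first.
  move=> al /(_ 0 isT) /= al0; have [|k ek] := AA (_ : A0 (al, flip 0 al)).
    apply/A0P; exists 0; split => //; first by rewrite /flip al0.
    by move=> i i0; rewrite /flip (negbTE i0).
  by exists k.
move=> k s; have [al [sal nal]] : exists al, bcyl s al /\ ~ C k al.
  apply: contrapT => /forallNP h; apply: nC; exists k, s => al sal.
  by apply: contrapT => nal; apply: (h al).
have [n nP] : exists n, forall be : cantor_space, agree n be al -> ~ C k be.
  have [al0|al0] := pselect (al 0 = false); last first.
    by exists 1 => be bal [be0 _]; apply: al0; rewrite -bal.
  have [|L LP] := @erased_edge_closed k (u al) (v (flip 0 al)).
    by move=> e; apply: nal.
  have [M MP] := (cantor_continuous_agree u).1 cu al L.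
  have [M' M'P] := (cantor_continuous_agree v).1 cv (flip 0 al) L.
  exists (maxn M M') => be bal [_]; apply: LP.
    by apply: MP; exact: agree_sub (leq_maxl _ _) bal.
  by apply: M'P; apply: flip_agree2; exact: agree_sub (leq_maxr _ _) bal.
have [r rE] := bcyl_ext sal (leq_maxl (size s) n).
exists r; rewrite -rE => be rbe; apply: nP => i ilt.
have im : i < maxn (size s) n by rewrite leq_max ilt orbT.
by rewrite rbe ?size_mkseq// nth_mkseq.
Qed.

(** Inside the cylinder where first edges have the constant index [k], take an edge [(a, b)] whose
    index exceeds [k]. By [mask_flip_erase] its effect vanishes after flipping at [k], so [v] agrees
    at [flip 0 a] and [flip 0 b], although [a] and [b] differ. *)
Lemma erased_set_reduction_not_injective : ~ injective v.
Proof.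
move=> vI; have [k [s sP]] := uniform_first_edge.
pose al : cantor_space := nth false s.
have [a [b [k' [A0ab aal bal _ [_ [ak' ak'0 vb] kk']]]]] :=
  late_edge al k 0 (size s).
have [a0 [aka aka0 va]] := sP a aal; have [b0 [bka bka0 vb0]] := sP b bal.
have E : mask (flip k (u a)) = mask (flip k (u b)).
  by apply: (mask_flip_erase kk') => //; rewrite -vb reduction_mask.
have ab : a = b by apply: (@flip_inj 0); apply: vI; rewrite va vb0.
by apply: (@A0_irrefl a); rewrite {2}ab.
Qed.

End NoInjectiveReduction.

Theorem theorem11 (R : realType) :
  (forall (X Y : topologicalType) (A : set (X * Y)),
     polish R X -> polish R Y -> borel A ->
     let a := potentially_closed R A in
     let b := exists (u : cantor_space -> X) (v : cantor_space -> Y),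
       [/\ continuous u, continuous v &
           A0 = [set p | A (u p.1, v p.2)] `&` closure A0] in
     (a \/ b) /\ ~ (a /\ b)) /\
  (exists (X Y : topologicalType) (A : set (X * Y)),
     [/\ polish R X, polish R Y, borel A, ~ potentially_closed R A &
         ~ exists (u : cantor_space -> X) (v : cantor_space -> Y),
             [/\ continuous u, continuous v, injective u, injective v &
                 A0 = [set p | A (u p.1, v p.2)] `&` closure A0]]) /\
  (exists (X Y : topologicalType) (A : set (X * Y)),
     [/\ polish R X, polish R Y, borel A, ~ potentially_closed R A &
         ~ exists (u : cantor_space -> X) (v : cantor_space -> Y),
             [/\ continuous u, continuous v &
                 A0 = [set p | A (u p.1, v p.2)]]]).
Proof.
have pC := cantor_polish R.
have cid : continuous (id : cantor_space -> cantor_space) by move=> x;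
  exact: cvg_id.
split; [|split].
- move=> X Y A pX pY bA /=; split.
    have [|[u [v [cu cv nA AA]]]] := potentially_closed_or_reduction pX pY bA.
      by left.
    by right; exists u, v; split => //;
      exact: (@reductionP _ _ A u v).2.
  move=> [pc [u [v [cu cv /(@reductionP _ _ A u v).1[nA AA]]]]].
  exact: (reduction_not_potentially_closed pX pY cu cv nA AA).
- exists cantor_space, cantor_space, erased_set; split => //.
  + exact: erased_set_borel.
  + apply: (reduction_not_potentially_closed pC pC cid mask_continuous).
      exact: erased_set_diagonal.
    exact: erased_set_edge.
  + move=> [u [v [cu cv _ vI /(@reductionP _ _ erased_set u v).1[nA AA]]]].
    exact: (erased_set_reduction_not_injective cu cv nA AA vI).
- exists cantor_space, cantor_space, [set p | p.1 <> p.2]; split => //.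
  + by apply: borel_open; exact: distinct_open.
  + apply: (reduction_not_potentially_closed pC pC cid cid) => [al|a b] /=.
      by apply.
    by move=> A0ab ab; apply: (@A0_irrefl a); rewrite {2}ab.
  + by move=> [u [v [_ _ /distinct_no_full_reduction]]].
Qed.
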